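(* For all integers $d\ge 1$ and $g\ge 0$, the mapping $\Phi_+$ is a bijection between the family $\mathcal{O}_d^{g}$ of right orientations of face-rooted maps of genus $g$ whose root-face has degree $d$, and the family $\mathcal{T}_d^{g}$ of mobiles of genus $g$ and excess $d$.
   Context: A map of genus $g$ is an embedding of a connected graph (loops and multiple edges allowed) on the closed oriented surface of genus $g$ such that every component of the complement (face) is homeomorphic to an open disk; maps are considered up to orientation-preserving homeomorphism. A face-rooted map has one marked face, the root-face $f_0$. A unicellular map is a map with exactly one face. Right orientations. Let $M$ be a face-rooted map with an orientation of its edges such that every vertex has at least one outgoing edge. For an edge $e$, the rightmost walk starting from $e$ is the (eventually looping) walk that starts with $e$, follows the orientation, and at each step takes the rightmost outgoing edge: for any two consecutive edges $e',e''$ of the walk, all edges strictly between $e'$ and $e''$ in counterclockwise order around their common vertex are ingoing. The orientation is a right orientation if every vertex has at least one outgoing edge and, for every edge $e$, the rightmost walk starting from $e$ eventually loops on the contour of $f_0$ with $f_0$ on its right side. Mobiles. A mobile of genus $g$ is a unicellular map of genus $g$ whose vertices are properly colored black and white (every edge joins a black vertex to a white vertex), where in addition each corner at a black vertex may carry dangling half-edges called buds. The excess of a mobile is its number of edges minus its number of buds. The mapping $\Phi_+$. Let $O\in\mathcal{O}_d^{g}$; color its vertices white. Insert a black vertex in each face of $O$. For each edge $e$ of $O$, directed from its origin $u$ to its end $v$: create an edge between $u$ and the black vertex in the face on the left of $e$ (drawn in that face, in the corner at $u$ next to $e$), and create a bud, pointing toward $e$, at the black vertex in the face on the right of $e$.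 Then delete the original edges of $O$, and delete the black vertex of the root-face (which is incident to $d$ buds and to no edge) together with its buds. The resulting embedded graph is $\Phi_+(O)$. *)

(* Defs.v *)
From HB Require Import structures.
From mathcomp Require Import all_boot all_fingroup ssralg ssrint.

Set Implicit Arguments.
Unset Strict Implicit.
Unset Printing Implicit Defensive.

Import GroupScope.

Section FirstReturn.

Variables (T : finType) (s : {perm T}) (A : {set T}).

Lemma return_ex (x : {x | x \in A}) : exists k, (s ^+ k.+1) (val x) \in A.
Proof. by exists #[s].-1; rewrite prednK // expg_order perm1 (valP x). Qed.

Definition return_time (x : {x | x \in A}) : nat := ex_minn (return_ex x).

Lemma return_subproof (x : {x | x \in A}) :
  (s ^+ (return_time x).+1) (val x) \in A.
Proof. by rewrite /return_time; case: ex_minnP. Qed.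

Definition first_return (x : {x | x \in A}) : {x | x \in A} :=
  Sub ((s ^+ (return_time x).+1) (val x)) (return_subproof x).

Lemma first_return_inj : injective first_return.
Proof.
move=> x y /(congr1 val) /=.
wlog le_xy : x y / (return_time x <= return_time y)%N.
  move=> IH; case/orP: (leq_total (return_time x) (return_time y)) => h e.
    exact: IH.
  by apply/esym/IH.
rewrite -{1}(subnK le_xy) -addnS addnC expgD permM => e.
have {e} : (s ^+ (return_time x).+1) (val x)
           = (s ^+ (return_time x).+1) ((s ^+ (return_time y - return_time x)) (val y)).
  by rewrite e -!permM -!expgD addnC.
move/perm_inj => e.
case dk: (return_time y - return_time x)%N e => [|k] e.
  by rewrite expg0 perm1 in e; apply: val_inj.
have kA : (s ^+ k.+1) (val y) \in A by rewrite -e (valP x).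
have : (return_time y <= k)%N.
  by rewrite /return_time; case: ex_minnP => m _; apply.
by rewrite -ltnS -dk ltnNge leq_subr.
Qed.

(* The cyclic orders left on [A] when the points outside [A] are erased from
   the cycles of [s]. *)
Definition induced_perm : {perm {x | x \in A}} := perm first_return_inj.

End FirstReturn.

(* Graphs embedded on an oriented surface, as rotation systems on half-edges.
   The cycles of [rot] are the vertices, each listed in counterclockwise order;
   [opp] exchanges the two halves of an edge and fixes the dangling
   half-edges. *)
Record ribbon := Ribbon {
  half :> finType;
  rot : {perm half};
  opp : {perm half};
  oppK : involutive opp
}.

Section Ribbon.

Variable G : ribbon.

Definition dangling : {set G} := [set h | opp G h == h].
Definition edges : {set {set G}} :=
  [set [set h; opp G h] | h in ~: dangling].
Definition vertices : {set {set G}} := porbits (rot G).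

(* Follows the contour of the face on the left of a half-edge, viewed as
   directed away from its vertex; products of permutations apply the left
   factor first.  A dangling half-edge is walked around inside its corner, so
   it does not affect the faces. *)
Definition fnext : {perm G} := opp G * (rot G)^-1.
Definition faces : {set {set G}} := porbits fnext.

(* Transitivity also implies that there is at least one half-edge: the map with
   one vertex and no edge is not represented. *)
Definition connected : Prop :=
  [transitive <<[set rot G; opp G]>>, on [set: G] | 'P].

Definition has_genus (g : nat) : Prop :=
  (#|vertices|%:Z - #|edges|%:Z + #|faces|%:Z = 2 - 2 * g%:Z :> int)%R.

Definition is_map (g : nat) : Prop := connected /\ has_genus g.

End Ribbon.

(* An orientation is given by the half-edges that are the origin part of their
   edge, and a face by the set of half-edges with this face on their left. *)
Record omap := OMap {
  obase :> ribbon;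
  out : {set obase};
  root_face : {set obase}
}.

Section RightOrientations.

Variable O : omap.

Definition face_rooted_map (g : nat) : Prop :=
  [/\ is_map O g, dangling O = set0 & root_face O \in faces O].

Definition orientation : Prop :=
  forall h : O, (opp O h \in out O) = (h \notin out O).

Definition every_vertex_has_outgoing : Prop :=
  forall X, X \in vertices O -> exists2 h, h \in X & h \in out O.

(* Directed edges are represented by their outgoing half-edge, so an edge [e]
   enters its end through [opp O e]. *)
Definition rightmost_step (e e' : O) : Prop :=
  exists k, [/\ e' = (rot O ^+ k.+1) (opp O e), e' \in out O &
    forall j, (0 < j < k.+1)%N -> (rot O ^+ j) (opp O e) \notin out O].

Definition rightmost_walk (e : O) (w : nat -> O) : Prop :=
  w 0 = e /\ forall n, rightmost_step (w n) (w n.+1).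

(* Having the root face on the right of [e] means having it on the left of
   [opp O e]; the contour with this face on the right then goes from [e] to
   [rot O (opp O e)]. *)
Definition loops_on_root_contour (w : nat -> O) : Prop :=
  exists2 N, opp O (w N) \in root_face O &
    forall k, w (N + k)%N = ((opp O * rot O) ^+ k) (w N).

Definition right_orientation : Prop :=
  [/\ orientation, every_vertex_has_outgoing &
      forall e, e \in out O ->
        forall w, rightmost_walk e w -> loops_on_root_contour w].

End RightOrientations.

Definition right_orientations (d g : nat) (O : omap) : Prop :=
  [/\ face_rooted_map O g, #|root_face O| = d & right_orientation O].

Definition omap_iso (O O' : omap) : Prop :=
  exists f : O -> O', [/\ bijective f,
    {morph f : h / rot O h >-> rot O' h},
    {morph f : h / opp O h >-> opp O' h},
    forall h, (f h \in out O') = (h \in out O) &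
    forall h, (f h \in root_face O') = (h \in root_face O)].

(* [black] is the set of half-edges incident to black vertices; the buds are
   the dangling half-edges. *)
Record mobile_data := MobileData {
  mbase :> ribbon;
  black : {set mbase}
}.

Definition excess (T : mobile_data) : int :=
  (#|edges T|%:Z - #|dangling T|%:Z)%R.

Definition properly_colored (T : mobile_data) : Prop :=
  (forall h : T, (rot T h \in black T) = (h \in black T)) /\
  (forall h : T, h \notin dangling T ->
     (opp T h \in black T) = (h \notin black T)).

Definition mobile (T : mobile_data) (g : nat) : Prop :=
  [/\ is_map T g, #|faces T| = 1%N, properly_colored T
    & dangling T \subset black T].

Definition mobiles (d g : nat) (T : mobile_data) : Prop :=
  mobile T g /\ excess T = d%:Z%R.

Definition mobile_iso (T T' : mobile_data) : Prop :=
  exists f : T -> T', [/\ bijective f,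
    {morph f : h / rot T h >-> rot T' h},
    {morph f : h / opp T h >-> opp T' h} &
    forall h, (f h \in black T') = (h \in black T)].

Section Phi.

Variable O : omap.

(* [inl h] stands for a possible half-edge at the origin of [h], in the corner
   on the left of [h] (the one preceding [rot O h]); [inr h] for a half-edge at
   the black vertex of the face on the left of [h], pointing towards the side
   of the edge of [h] (or the corner before it). *)
Definition slot_rot (x : O + O) : O + O :=
  match x with
  | inl h => inl (rot O h)
  | inr h => inr (fnext O h)
  end.

Lemma slot_rot_inj : injective slot_rot.
Proof. by move=> [x|x] [y|y] //= [] /perm_inj ->. Qed.

(* An outgoing [h] gives the edge with halves [inl h] and [inr h]; otherwise
   the face on the left of [h] is on the right of its directed edge and [inr h]
   is a bud.  Deleting the black vertex of the root face deletes the half-edges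
   there, together with the opposite ones (there are none of the latter for a
   right orientation). *)
Definition slots : {set O + O} :=
  [set x | match x with
           | inl h => (h \in out O) && (h \notin root_face O)
           | inr h => h \notin root_face O
           end].

Definition slot_opp (x : O + O) : O + O :=
  match x with
  | inl h => inr h
  | inr h => if h \in out O then inl h else inr h
  end.

Lemma slot_opp_slots (x : {x | x \in slots}) : slot_opp (val x) \in slots.
Proof.
case: x => [[h|h]] /=; rewrite !inE; first by case/andP.
by move=> hf; case: ifP => ho; rewrite ?ho.
Qed.

Definition phi_opp (x : {x | x \in slots}) : {x | x \in slots} :=
  Sub (slot_opp (val x)) (slot_opp_slots x).

Lemma phi_oppK : involutive phi_opp.
Proof.
case=> [[h|h] hP]; apply: val_inj => /=; last by case: ifP => //= ->.
by move: hP; rewrite inE => /andP[-> _].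
Qed.

Definition phi_opp_perm : {perm {x | x \in slots}} := perm (inv_inj phi_oppK).

Lemma phi_opp_permK : involutive phi_opp_perm.
Proof. by move=> x; rewrite !permE phi_oppK. Qed.

Definition phi_ribbon : ribbon :=
  {| half := {x | x \in slots};
     rot := induced_perm (perm slot_rot_inj) slots;
     opp := phi_opp_perm;
     oppK := phi_opp_permK |}.

Definition Phi_plus : mobile_data :=
  {| mbase := phi_ribbon;
     black := [set x : phi_ribbon | if val x is inr _ then true else false] |}.

End Phi.

(* [F] induces a bijection from the [eqA]-classes of elements of [P] to the
   [eqB]-classes of elements of [Q]. *)
Definition bijection_on_classes (A B : Type) (P : A -> Prop)
    (eqA : A -> A -> Prop) (Q : B -> Prop) (eqB : B -> B -> Prop)
    (F : A -> B) : Prop :=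
  [/\ forall x, P x -> Q (F x),
      forall x y, P x -> P y -> eqA x y -> eqB (F x) (F y),
      forall x y, P x -> P y -> eqB (F x) (F y) -> eqA x y &
      forall z, Q z -> exists2 x, P x & eqB (F x) z].

(* Main.v *)
Require Import Defs.
From mathcomp Require Import all_boot.
From mathcomp Require Import all_fingroup ssralg ssrint order ssrnum zify.
Import Defs.

(** Walk along the contours of a mobile, and let a height change on the way: it
    goes up by one when the walk leaves a black vertex along an edge (an
    opening) and down by one at each bud.  A rise from an opening [x] is a
    stretch of the walk, starting with the step of [x], along which the height
    stays above its initial value and at the end of which it is one above it.
    Read backwards, a rise stops at the first place where the height has changed
    by one, so its end determines its start ([rises_uniq]); call the start the
    parent of the end.  If the end is a bud, the opening and the bud are
    matched, as parentheses are.

    For the image of a right orientation, this height structure knows everything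
    about the map.  An edge [e] of the map gives the opening of its left side;
    the bud of its right side, if there is one, is matched with this opening
    ([Rise_match]), and the parent of the opening of [k] is the opening of the
    edge that follows [k] on the rightmost walk ([Rise_step]).  Both facts are
    proved together, by induction on the tree formed by the rightmost walks,
    which lead to the contour of the root-face: from the opening of [e], the
    contour of the mobile turns around the corner on the right of [e]
    and meets the openings of the edges that enter this corner, each of them
    followed by its excursion, until it reaches the bud of [e] ([Rise_chain]).

    The three assertions follow.  The parents connect all the openings to the
    root contour, so the mobile has one contour; it is then connected, because the
    contour walk belongs to the group generated by rotation and opposition, and
    its genus and excess are obtained by counting.  An isomorphism between the
    images of two right orientations preserves rises, hence the pairing of the
    two sides of each edge and the rightmost walks, and it extends to the
    root-face through the opposite half-edges ([phi_morph_iso]).  Conversely,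
    when the excess of a mobile is positive, the height drifts upwards along its
    unique contour, so every half-edge has a parent ([rises_ex]) and every bud
    is matched.  The closure of the mobile takes the matching as opposition, the
    black rotation as the contours of the inner faces, and the cyclic order of
    the unmatched openings as the contour of the root-face.  The rises with a
    given start describe a corner of the closure ([ingoing_corner]): this shows
    that its white rotation is that of the mobile and that its rightmost walks go
    from each edge to its parent.  The excursions get longer from an edge to its
    parent, so these walks end at unmatched openings, on the root contour. *)

Set Implicit Arguments.
Unset Strict Implicit.
Unset Printing Implicit Defensive.

Import GroupScope.

(** * Iterates and first returns of permutations *)

Section Iterates.

Variables (T : finType) (s : {perm T}).
Implicit Types (x y : T) (i j n : nat).

Lemma perm_iterS n x : (s ^+ n.+1) x = s ((s ^+ n) x).
Proof. by rewrite expgSr permM. Qed.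

Lemma perm_iterSr n x : (s ^+ n.+1) x = (s ^+ n) (s x).
Proof. by rewrite expgS permM. Qed.

Lemma perm_iterD m n x : (s ^+ (m + n)) x = (s ^+ n) ((s ^+ m) x).
Proof. by rewrite expgD permM. Qed.

Lemma perm_iter1 x : (s ^+ 1) x = s x.
Proof. by rewrite expg1. Qed.

Lemma perm_iter0 x : (s ^+ 0) x = x.
Proof. by rewrite expg0 perm1. Qed.

Lemma perm_iter_sub i n x y :
  (i <= n)%N -> (s ^+ n) x = (s ^+ i) y -> (s ^+ (n - i)) x = y.
Proof.
move=> le_in e; apply: (@perm_inj _ (s ^+ i)).
by rewrite -perm_iterD subnK.
Qed.

Lemma first_visit_uniq (A : {set T}) x i j :
  (s ^+ i.+1) x \in A -> (forall k, (0 < k < i.+1)%N -> (s ^+ k) x \notin A) ->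
  (s ^+ j.+1) x \in A -> (forall k, (0 < k < j.+1)%N -> (s ^+ k) x \notin A) ->
  i = j.
Proof.
move=> iA noi jA noj; case: (ltngtP i j) => [lt|lt|//].
  by have := noj i.+1; rewrite iA => /(_ lt).
by have := noi j.+1; rewrite jA => /(_ lt).
Qed.

Lemma last_visit_uniq (A : {set T}) x y i j :
  (s ^+ i.+1) x = (s ^+ j.+1) y -> x \in A -> y \in A ->
  (forall k, (0 < k < i.+1)%N -> (s ^+ k) x \notin A) ->
  (forall k, (0 < k < j.+1)%N -> (s ^+ k) y \notin A) -> x = y.
Proof.
wlog le_ij : x y i j / (i <= j)%N.
  move=> IH e xA yA nox noy; case/orP: (leq_total i j) => h.
    exact: (IH x y i j).
  exact/esym/(IH y x j i).
move=> e xA yA _ noy.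
have ex : (s ^+ (j - i)) y = x by rewrite -subSS (perm_iter_sub _ (esym e)).
case: (posnP (j - i)%N) => [d0|d0]; first by rewrite -ex d0 perm_iter0.
by have := noy (j - i)%N; rewrite ex xA d0 ltnS leq_subr => /(_ isT).
Qed.

End Iterates.

Lemma perm_iter_morph (T T' : finType) (s : {perm T}) (s' : {perm T'})
    (f : T -> T') n x :
  {morph f : y / s y >-> s' y} -> f ((s ^+ n) x) = (s' ^+ n) (f x).
Proof.
move=> fs; elim: n => [|n IH]; first by rewrite !perm_iter0.
by rewrite !perm_iterS fs IH.
Qed.

Section FirstReturnTheory.

Variables (T : finType) (s : {perm T}) (A : {set T}).
Implicit Types x y : {x | x \in A}.

Lemma induced_permP x :
  exists k, val (induced_perm s A x) = (s ^+ k.+1) (val x) /\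
    forall j, (0 < j < k.+1)%N -> (s ^+ j) (val x) \notin A.
Proof.
exists (return_time s x); split; first by rewrite permE.
move=> [//|j] /=; rewrite ltnS /return_time.
case: ex_minnP => m _ min_m lt_jm; apply/negP => /min_m.
by rewrite leqNgt lt_jm.
Qed.

Lemma induced_perm_eq x y k :
  (forall j, (0 < j < k.+1)%N -> (s ^+ j) (val x) \notin A) ->
  val y = (s ^+ k.+1) (val x) -> induced_perm s A x = y.
Proof.
move=> notA def_y; have [m [def_m notA']] := induced_permP x.
apply: val_inj; rewrite def_m def_y (@first_visit_uniq _ s A (val x) m k) //.
  by rewrite -def_m (valP (induced_perm s A x)).
by rewrite -def_y (valP y).
Qed.

Lemma porbit_induced x y :
  (y \in porbit (induced_perm s A) x) = (val y \in porbit s (val x)).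
Proof.
apply/porbitP/porbitP => [[i ->]|[i]].
  elim: i => [|i [j IH]]; first by exists 0; rewrite !perm_iter0.
  have [k [def_k _]] := induced_permP ((induced_perm s A ^+ i) x).
  by exists (j + k.+1); rewrite perm_iterS def_k IH -perm_iterD.
elim/ltn_ind: i x => i IH x def_y.
have [k [def_k notA]] := induced_permP x.
case: i => [|i] in IH def_y *.
  by exists 0; apply: val_inj; rewrite def_y !perm_iter0.
have le_ki : (k <= i)%N.
  rewrite leqNgt; apply/negP => lt_ik.
  by have := notA i.+1; rewrite -def_y (valP y) => /(_ lt_ik).
have [||j ->] := IH (i - k)%N _ (induced_perm s A x).
- by rewrite ltnS leq_subr.
- by rewrite def_k -perm_iterD def_y; congr ((s ^+ _) _); lia.
by exists j.+1; rewrite perm_iterSr.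
Qed.

(** Erasing points from the cycles of [s] removes the cycles that avoid [A], and
    keeps the others apart. *)
Lemma card_porbits_induced :
  #|porbits (induced_perm s A)| = #|[set X in porbits s | X :&: A != set0]|.
Proof.
have -> : porbits (induced_perm s A) =
    (fun X : {set T} => [set x : {x | x \in A} | val x \in X])
      @: [set X in porbits s | X :&: A != set0].
  apply/setP => Y; apply/imsetP/imsetP => [[x _ ->]|[X]].
    exists (porbit s (val x)).
      rewrite !inE imset_f //=; apply/set0Pn; exists (val x).
      by rewrite inE porbit_id (valP x).
    by apply/setP => y; rewrite inE porbit_induced.
  rewrite inE => /andP[/imsetP[x _ ->]] /set0Pn[y]; rewrite inE => /andP[xy yA] ->.
  exists (Sub y yA : {x | x \in A}) => //; apply/setP => z.
  rewrite inE porbit_induced /=.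
  by have := xy; rewrite -eq_porbit_mem => /eqP ->.
rewrite card_in_imset // => X Y.
rewrite !inE => /andP[/imsetP[x _ ->]] /set0Pn[u]; rewrite inE => /andP[xu uA].
move=> /andP[/imsetP[y _ ->]] /set0Pn[v]; rewrite inE => /andP[yv vA].
move/setP/(_ (Sub u uA : {x | x \in A})); rewrite !inE /= xu => /esym.
by move: xu; rewrite -!eq_porbit_mem => /eqP <- /eqP ->.
Qed.

End FirstReturnTheory.

Lemma induced_perm_morph (T T' : finType) (s : {perm T}) (s' : {perm T'})
    (A : {set T}) (A' : {set T'}) (f : T -> T')
    (F : {x | x \in A} -> {x | x \in A'}) :
  {morph f : x / s x >-> s' x} -> (forall x, (f x \in A') = (x \in A)) ->
  (forall x, val (F x) = f (val x)) ->
  {morph F : x / induced_perm s A x >-> induced_perm s' A' x}.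
Proof.
move=> fs fA valF x; have [k [def_k notA]] := induced_permP s x.
have fsn n y : f ((s ^+ n) y) = (s' ^+ n) (f y) by exact: perm_iter_morph.
apply/esym/(@induced_perm_eq _ _ _ _ _ k) => [j /notA|]; rewrite !valF.
  by rewrite -fsn fA.
by rewrite def_k fsn.
Qed.

Lemma card_porbits_bij (T T' : finType) (s : {perm T}) (s' : {perm T'})
    (f : T -> T') :
  bijective f -> {morph f : x / s x >-> s' x} -> #|porbits s| = #|porbits s'|.
Proof.
move=> [f' fK f'K] fs; have f_inj := can_inj fK.
have fsn n y : f ((s ^+ n) y) = (s' ^+ n) (f y) by exact: perm_iter_morph.
have fP x : f @: porbit s x = porbit s' (f x).
  apply/setP => y; apply/imsetP/porbitP => [[z /porbitP[i ->] ->]|[i ->]].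
    by exists i; rewrite fsn.
  by exists ((s ^+ i) x); rewrite ?mem_porbit ?fsn.
rewrite -(card_imset _ (imset_inj f_inj)); congr #|pred_of_set _|.
apply/setP => X; apply/imsetP/imsetP => [[_ /imsetP[x _ ->] ->]|[y _ ->]].
  by exists (f x); rewrite ?fP.
by exists (porbit s (f' y)); rewrite ?imset_f // fP f'K.
Qed.

(** * Rises and excursions of a height along a permutation *)

Section Rises.

Variables (X : finType) (s : {perm X}) (P N : {set X}).
Implicit Types (x y z : X) (i j k m n : nat).

(** The openings of a mobile play the role of [P], and its buds that of [N]. *)
Definition weight x : int := ((x \in P)%:Z - (x \in N)%:Z)%R.

Definition gain x n : int := (\sum_(i < n) weight ((s ^+ i)%g x))%R.

(** The step taken from the end [(s ^+ n) x] is not counted, so the end can be of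
    any kind.  If it is in [N], that step brings the height back to zero: the
    excursion from [x] is complete, and [(s ^+ n) x] is the closing parenthesis
    of [x]. *)
Definition rises x n : bool :=
  [&& (0 < n)%N, gain x n == 1%R & [forall j : 'I_n, (0 < gain x j.+1)%R]].

Lemma gain0 x : gain x 0 = 0%R.
Proof. by rewrite /gain big_ord0. Qed.

Lemma gainS x n : gain x n.+1 = (gain x n + weight ((s ^+ n)%g x))%R.
Proof. by rewrite /gain big_ord_recr. Qed.

Lemma gain1 x : gain x 1 = weight x.
Proof. by rewrite gainS gain0 perm_iter0; lia. Qed.

Lemma gainD x m n : gain x (m + n) = (gain x m + gain ((s ^+ m)%g x) n)%R.
Proof.
elim: n => [|n IH]; first by rewrite addn0 gain0; lia.
by rewrite addnS !gainS IH perm_iterD; lia.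
Qed.

Lemma risesP x n :
  reflect [/\ (0 < n)%N, gain x n = 1%R
            & forall j, (0 < j <= n)%N -> (0 < gain x j)%R] (rises x n).
Proof.
apply: (iffP and3P) => [[n0 /eqP e /forallP h]|[n0 e h]]; split=> //.
- by case=> [//|j] /= lt_jn; apply: (h (Ordinal lt_jn)).
- exact/eqP.
by apply/forallP => j; apply: h; rewrite /=.
Qed.

(** Read backwards from its end, a rise stops as soon as the height has changed
    by one, so its end determines its start. *)
Lemma rises_uniq x y m n :
  rises x m -> rises y n -> (s ^+ m) x = (s ^+ n) y -> m = n /\ x = y.
Proof.
wlog le_mn : x y m n / (m <= n)%N.
  move=> IH rx ry e; case/orP: (leq_total m n) => h; first exact: IH.
  by have [-> ->] := IH y x n m h ry rx (esym e).
move=> rx ry /esym/(perm_iter_sub le_mn) e.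
case/risesP: (rx) => m0 ex hx; case/risesP: (ry) => n0 ey hy.
case: (ltnP m n) => [lt_mn|ge_mn].
  have := hy (n - m)%N; have := gainD y (n - m) m; rewrite e subnK // ex ey.
  lia.
have <- : m = n by lia.
split=> //; rewrite -e; have -> : (n - m = 0)%N by lia.
by rewrite perm_iter0.
Qed.

Hypothesis disjPN : [disjoint P & N].

Lemma weight_P x : x \in P -> weight x = 1%R.
Proof. by move=> xP; rewrite /weight xP (disjointFr disjPN xP). Qed.

Lemma weight_N x : x \in N -> weight x = (-1)%R.
Proof. by move=> xN; rewrite /weight xN (disjointFl disjPN xN). Qed.

Lemma weight_0 x : x \notin P -> x \notin N -> weight x = 0%R.
Proof. by rewrite /weight => /negPf-> /negPf->. Qed.

Variant weight_spec x : int -> bool -> bool -> Type :=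
  | WeightP of x \in P : weight_spec x 1%R true false
  | WeightN of x \in N : weight_spec x (-1)%R false true
  | Weight0 of x \notin P & x \notin N : weight_spec x 0%R false false.

Lemma weightP x : weight_spec x (weight x) (x \in P) (x \in N).
Proof.
have [xP|xP] := boolP (x \in P).
  by rewrite weight_P // (disjointFr disjPN xP); constructor.
have [xN|xN] := boolP (x \in N); first by rewrite weight_N //; constructor.
by rewrite weight_0 //; constructor.
Qed.

Lemma rises_start x n : rises x n -> x \in P.
Proof.
case/risesP => n0 _ /(_ 1%N n0); rewrite gain1.
by case: weightP.
Qed.

Lemma rises1 x : x \in P -> rises x 1.
Proof.
move=> xP; apply/risesP; split=> // [|j hj].
  by rewrite gain1 weight_P.
have -> : j = 1%N by lia.
by rewrite gain1 weight_P.
Qed.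

Lemma rises_neutral x n :
  rises x n -> (s ^+ n) x \notin P -> (s ^+ n) x \notin N -> rises x n.+1.
Proof.
case/risesP => n0 e h hP hN; apply/risesP.
have e' : gain x n.+1 = 1%R by rewrite gainS e weight_0.
split=> // j /andP[j0]; rewrite leq_eqVlt => /orP[/eqP ->|]; first by rewrite e'.
by rewrite ltnS => le_jn; apply: h; rewrite j0.
Qed.

(** Closing an excursion that starts at the current height brings the walk back
    to this height. *)
Lemma rises_excursion x n m :
  rises x n -> rises ((s ^+ n) x) m -> (s ^+ (n + m)) x \in N ->
  rises x (n + m).+1.
Proof.
case/risesP => n0 e h /risesP[m0 e' h'] yN.
have e2 : gain x (n + m).+1 = 1%R.
  by rewrite gainS weight_N // gainD e e'; lia.
apply/risesP; split=> // j /andP[j0]; rewrite leq_eqVlt => /orP[/eqP ->|le_j].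
  by rewrite e2.
case: (leqP j n) => [le_jn|lt_nj]; first by apply: h; rewrite j0.
have -> : j = (n + (j - n))%N by lia.
rewrite gainD e; have := h' (j - n)%N; lia.
Qed.

(** The first return to height zero ends an excursion, since the height varies
    by at most one. *)
Lemma excursion_ex x k :
  x \in P -> (gain x k <= 0)%R -> (0 < k)%N ->
  exists n, [/\ (n < k)%N, rises x n & (s ^+ n) x \in N].
Proof.
move=> xP; elim/ltn_ind: k => k IH le0 k0.
have ex : exists j, (0 < j)%N && (gain x j <= 0)%R by exists k; rewrite k0.
case: (ex_minnP ex) => [[|n]] // /andP[_ le_n] min_n.
have n_k : (n < k)%N by apply: min_n; rewrite k0.
have pos j : (0 < j <= n)%N -> (0 < gain x j)%R.
  case/andP=> j0 le_jn; have := min_n j; rewrite j0 /=; lia.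
have n0 : (0 < n)%N.
  by case: n le_n {min_n n_k pos} => //; rewrite gain1 weight_P.
have := pos n; rewrite n0 leqnn => /(_ isT) pos_n.
move: le_n; rewrite gainS; case: weightP => // sN; try lia.
move=> le_n; exists n; split=> //; apply/risesP; split=> //; lia.
Qed.

Lemma excursion_uniq x m n :
  rises x m -> (s ^+ m) x \in N -> rises x n -> (s ^+ n) x \in N -> m = n.
Proof.
wlog le_mn : m n / (m <= n)%N.
  move=> IH hm hmN hn hnN; case/orP: (leq_total m n) => h; first exact: IH.
  by apply/esym/IH.
move=> /risesP[_ e _] mN /risesP[_ _ hy] _.
have := gainS x m; rewrite weight_N // e.
case: (ltnP m n) => lt_mn; last by lia.
have := hy m.+1; lia.
Qed.

(** The walk is periodic: beyond one turn, which has a positive gain, the gains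
    of the first turn would come again on top of it and never reach zero.  This
    makes the existence of an excursion decidable. *)
Lemma excursion_bound x n : rises x n -> (s ^+ n) x \in N -> (n < #[s])%N.
Proof.
move=> rx nN; case/risesP: rx => n0 e h.
rewrite ltnNge; apply/negP => le_sn.
have o0 : (0 < #[s])%N by exact: order_gt0.
have := gainS x n; rewrite weight_N // e.
have -> : n.+1 = (#[s] + (n.+1 - #[s]))%N by lia.
rewrite gainD expg_order perm1.
have h1 := h #[s]; have h2 := h (n.+1 - #[s])%N; lia.
Qed.

Definition matched x y : bool :=
  (y \in N) && [exists n : 'I_(#[s]), rises x n && ((s ^+ n) x == y)].

Lemma matchedP x y :
  reflect (exists2 n, rises x n & (s ^+ n) x = y /\ y \in N) (matched x y).
Proof.
apply: (iffP andP) => [[yN /existsP[n /andP[r /eqP e]]]|[n r [e yN]]].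
  by exists n.
split=> //; have := excursion_bound r; rewrite e yN => /(_ isT) lt_n.
by apply/existsP; exists (Ordinal lt_n); rewrite /= r e eqxx.
Qed.

Lemma matched_end x y : matched x y -> y \in N.
Proof. by case/andP. Qed.

Lemma matched_start x y : matched x y -> x \in P.
Proof. by case/matchedP => n /rises_start. Qed.

Lemma matched_fun x y z : matched x y -> matched x z -> y = z.
Proof.
case/matchedP => n r [e yN] /matchedP[m r' [e' zN]].
by rewrite -e -e' (@excursion_uniq x n m) ?e ?e'.
Qed.

Lemma matched_inj x y z : matched x z -> matched y z -> x = y.
Proof.
case/matchedP => n r [e yN] /matchedP[m r' [e' zN]].
by have [|_ ->] := rises_uniq r r'; first by rewrite e e'.
Qed.

Lemma rises_match x n : rises x n -> (s ^+ n) x \in N -> matched x ((s ^+ n) x).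
Proof. by move=> r hN; apply/matchedP; exists n. Qed.

(** The excursion of [(s ^+ n) x] takes place above height one, inside the
    excursion of its parent [x]. *)
Lemma match_longer x n m k :
  rises x n -> rises ((s ^+ n) x) m -> (s ^+ (n + m)) x \in N ->
  rises x k -> (s ^+ k) x \in N -> (m < k)%N.
Proof.
move=> rn rm mN rk kN; have /risesP[_ e pos] := rises_excursion rn rm mN.
rewrite ltnNge; apply/negP => le_km; case/risesP: rk => _ ek _.
have := gainS x k; rewrite weight_N // ek; have := pos k.+1; lia.
Qed.

Definition unmatched : {set X} := [set x in P | [forall y, ~~ matched x y]].

(** By [excursion_ex], only a matched opening sees the height come back. *)
Lemma unmatched_gain x k : x \in unmatched -> (0 < k)%N -> (0 < gain x k)%R.
Proof.
rewrite inE => /andP[xP /forallP no] k0; rewrite Order.TotalTheory.ltNge.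
apply/negP => le0; have [n [_ r rN]] := excursion_ex xP le0 k0.
by have := no ((s ^+ n) x); rewrite rises_match.
Qed.

(** From an unmatched opening on, the height stays above its value there.  If the
    rise ends at one, then the height never comes back to zero, and an unmatched
    opening met inside the rise would make its final value larger than one. *)
Lemma rises_unmatched x n :
  rises x n -> (s ^+ n) x \in unmatched ->
  x \in unmatched /\
  forall j, (0 < j < n)%N -> (s ^+ j) x \notin unmatched.
Proof.
move=> r nU; case/risesP: (r) => n0 e pos; split.
  rewrite inE (rises_start r); apply/forallP => y; apply/negP.
  case/matchedP => m /risesP[m0 em posm] [ey yN].
  have := gainS x m; rewrite weight_N ?ey // em => e0.
  have := pos m.+1; case: (leqP m.+1 n) => [|lt_nm]; first by lia.
  have := unmatched_gain (k := (m.+1 - n)%N) nU.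
  have := gainD x n (m.+1 - n); rewrite subnKC; last by lia.
  rewrite e e0; lia.
move=> j hj; apply/negP => jU.
have := unmatched_gain (k := (n - j)%N) jU.
have := gainD x j (n - j); rewrite subnKC; last by lia.
have := pos j; lia.
Qed.

Section SingleCycle.

Hypothesis one_cycle : forall x, porbit s x = [set: X].
Hypothesis ltNP : (#|N| < #|P|)%N.

(** One turn of the cycle visits each point once, whatever the start. *)
Lemma gain_turn x : gain x #|X| = (#|P|%:Z - #|N|%:Z)%R.
Proof.
have sumE (A : {set X}) : (\sum_y ((y \in A)%:Z : int) = #|A|%:Z)%R.
  rewrite -sum1_card [in RHS]big_mkcond /=.
  apply: (big_rec2 (fun (a : int) (b : nat) => (a = b%:Z)%R)) => // y a b _ ->.
  by case: (y \in A); lia.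
rewrite /gain.
have -> : (\sum_(i < #|X|) weight ((s ^+ i)%g x) = \sum_y weight y)%R.
  have sz : #|porbit s x| = #|X| by rewrite one_cycle cardsT.
  rewrite -(big_map (fun i : 'I_#|X| => (s ^+ i) x) predT weight) /=.
  apply: perm_big; apply: uniq_perm => [||y].
  - rewrite map_inj_uniq ?index_enum_uniq // => i j eij.
    apply/val_inj; have := uniq_traject_porbit s x; rewrite sz => /uniqP.
    move=> /(_ x i j); rewrite !inE size_traject !ltn_ord => /(_ isT isT).
    by rewrite !nth_traject // !(permX s) in eij *; apply.
  - exact: index_enum_uniq.
  rewrite mem_index_enum; apply/mapP.
  have : y \in porbit s x by rewrite one_cycle inE.
  rewrite porbit_traject sz => /trajectP[i lt_i ->].
  by exists (Ordinal lt_i); rewrite ?mem_index_enum // permX.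
rewrite /weight big_split /= sumE; congr (_ + _)%R.
rewrite -sumE; apply: (big_rec2 (fun a b : int => a = - b)%R) => // y a b _ ->.
by case: (y \in N); lia.
Qed.

(** The height one gained by a full turn backwards from [z] is positive, so the
    value one is reached for a first time; the rise starts there. *)
Lemma rises_ex z : exists2 x, x \in P & exists2 n, rises x n & (s ^+ n) x = z.
Proof.
pose back j := (s ^+ j)^-1 z.
have backK j : (s ^+ j) (back j) = z by rewrite permKV.
have backD i j : (s ^+ i) (back (i + j)%N) = back j.
  by apply: (@perm_inj _ (s ^+ j)); rewrite -perm_iterD !backK.
have ex : exists j, (0 < gain (back j) j)%R.
  by exists #|X|; rewrite gain_turn; lia.
case: (ex_minnP ex) => [[|n]]; first by rewrite gain0.
move=> pos min_n; exists (back n.+1).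
  have := gainD (back n.+1) 1 n; rewrite add1n (backD 1%N) gain1.
  have := min_n n; case: weightP => //; lia.
exists n.+1 => //.
have gain_back i : (i <= n.+1)%N ->
  gain (back n.+1) n.+1 = (gain (back n.+1) i + gain (back (n.+1 - i)%N) (n.+1 - i)%N)%R.
  move=> le_i; rewrite -{2}(subnKC le_i) gainD; congr (_ + gain _ _)%R.
  by rewrite -{1}(subnKC le_i) backD.
have e : gain (back n.+1) n.+1 = 1%R.
  have := min_n n; have := gain_back 1%N; rewrite gain1 subn1 /=.
  by case: weightP; lia.
apply/risesP; split=> // j hj.
have := gain_back j; have := min_n (n.+1 - j)%N; lia.
Qed.

Lemma matched_ex y : y \in N -> exists x, matched x y.
Proof.
move=> yN; have [x _ [n r e]] := rises_ex y.
by exists x; apply/matchedP; exists n.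
Qed.

(** A rise of more than one step ends with a neutral step or with a complete
    excursion, which can be removed. *)
Lemma rises_back x n :
  rises x n.+2 ->
  ((s ^+ n.+1) x \in N /\ exists m z,
     [/\ (m < n.+1)%N, rises x m.+1, (s ^+ m.+1) x = z & matched z ((s ^+ n.+1) x)]) \/
  [/\ (s ^+ n.+1) x \notin N, (s ^+ n.+1) x \notin P & rises x n.+1].
Proof.
move=> r; case/risesP: (r) => _ e pos.
have := gainS x n.+1; rewrite e; case: weightP => [hP|hN|hP hN] e1.
- have := pos n.+1; lia.
- left; split=> //; have [z /[dup] zy /matchedP[m r' [e' _]]] := matched_ex hN.
  case/risesP: (r') => m0 em posm.
  have lt_mn : (m < n.+1)%N.
    rewrite ltnNge; apply/negP => le_nm.
    have ex : x = (s ^+ (m - n.+1)) z by rewrite (perm_iter_sub le_nm e').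
    have := gainS z m; rewrite e' weight_N // em => e0.
    have := gainD z (m - n.+1) n.+2; rewrite -ex e.
    have -> : (m - n.+1 + n.+2 = m.+1)%N by lia.
    rewrite e0; have := posm (m - n.+1)%N.
    by case ek: (m - n.+1)%N => [|k]; rewrite ?gain0; lia.
  have ez : (s ^+ (n.+1 - m)) x = z.
    by apply: perm_iter_sub (ltnW lt_mn) (esym e').
  exists (n - m)%N, z; split=> //; try lia; last first.
    by rewrite -ez; congr ((s ^+ _) _); lia.
  apply/risesP; split=> // [|j hj]; last by apply: pos; lia.
  have := gainD x (n.+1 - m) m.+1; rewrite ez gainS e' weight_N // em.
  have -> : (n.+1 - m + m.+1 = n.+2)%N by lia.
  have -> : ((n - m).+1 = n.+1 - m)%N by lia.
  rewrite e; lia.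
- right; split=> //; apply/risesP; split=> // [|j hj]; first by lia.
  by apply: pos; lia.
Qed.

End SingleCycle.

End Rises.

(** * Ribbon graphs *)

Section RibbonTheory.

Variable G : ribbon.
Implicit Types h : G.

Lemma oppr_inj : injective (opp G).
Proof. exact: perm_inj. Qed.

Lemma fnextE h : fnext G h = (rot G)^-1 (opp G h).
Proof. by rewrite /fnext permM. Qed.

Lemma fnext_eq h k : rot G k = opp G h -> fnext G h = k.
Proof. by move=> e; rewrite fnextE -e permK. Qed.

Lemma rot_fnext h : rot G (fnext G h) = opp G h.
Proof. by rewrite fnextE permKV. Qed.

Lemma fnextVE h : (fnext G)^-1 h = opp G (rot G h).
Proof. by apply: (@perm_inj _ (fnext G)); rewrite permKV fnextE oppK permK. Qed.

Lemma fnext_opp_rot h : fnext G (opp G (rot G h)) = h.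
Proof. by rewrite -fnextVE permKV. Qed.

Lemma rotE h : rot G h = opp G ((fnext G)^-1 h).
Proof. by rewrite fnextVE oppK. Qed.

Lemma connected_orbit (x : G) :
  (forall y, y \in orbit 'P <<[set rot G; opp G]>> x) -> connected G.
Proof.
move=> h; apply/imsetP; exists x => //.
by apply/setP => y; rewrite inE h.
Qed.

Lemma orbit_gen (x y : G) (a : {perm G}) : a \in <<[set rot G; opp G]>> ->
  (a y \in orbit 'P <<[set rot G; opp G]>> x) =
  (y \in orbit 'P <<[set rot G; opp G]>> x).
Proof.
by move=> ag; rewrite -!orbit_eq_mem -[a y]/('P%act y a) (orbit_act 'P y ag).
Qed.

Lemma orbit_rot (x y : G) :
  (rot G y \in orbit 'P <<[set rot G; opp G]>> x) =
  (y \in orbit 'P <<[set rot G; opp G]>> x).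
Proof. by apply: orbit_gen; rewrite mem_gen // !inE eqxx. Qed.

Lemma orbit_opp (x y : G) :
  (opp G y \in orbit 'P <<[set rot G; opp G]>> x) =
  (y \in orbit 'P <<[set rot G; opp G]>> x).
Proof. by apply: orbit_gen; rewrite mem_gen // !inE eqxx orbT. Qed.

Lemma orbit_fnext (x y : G) :
  (fnext G y \in orbit 'P <<[set rot G; opp G]>> x) =
  (y \in orbit 'P <<[set rot G; opp G]>> x).
Proof. by rewrite -orbit_rot rot_fnext orbit_opp. Qed.

(** [fnext] belongs to the group generated by [rot] and [opp]. *)
Lemma one_face_connected (x : G) :
  porbit (fnext G) x = [set: G] -> connected G.
Proof.
move=> e; apply: (@connected_orbit x) => y.
have : y \in porbit (fnext G) x by rewrite e inE.
case/porbitP=> i ->; elim: i => [|i IH]; first by rewrite perm_iter0 orbit_refl.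
by rewrite perm_iterS orbit_fnext.
Qed.

(** Such a set [A] is a transversal of the edges. *)
Lemma card_edges (A : {set G}) :
  [disjoint A & dangling G] ->
  (forall h, h \notin dangling G -> (opp G h \in A) = (h \notin A)) ->
  #|edges G| = #|A|.
Proof.
move=> dA oppA.
have nd h : h \in A -> h \notin dangling G by move=> hA; rewrite (disjointFr dA hA).
have -> : edges G = (fun h => [set h; opp G h]) @: A.
  apply/setP => Y; apply/imsetP/imsetP => [[h]|[h hA ->]]; last first.
    by exists h; rewrite // inE nd.
  rewrite inE => hd ->; have [hA|hA] := boolP (h \in A); first by exists h.
  exists (opp G h); first by rewrite oppA.
  by rewrite oppK setUC.
rewrite card_in_imset // => h k hA kA /setP/(_ h).
rewrite !inE eqxx /= => /esym/orP[/eqP //|/eqP e].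
by move: hA; rewrite e oppA ?kA // nd.
Qed.

End RibbonTheory.

Lemma iso_card (G G' : ribbon) (f : G -> G') :
  bijective f -> {morph f : h / rot G h >-> rot G' h} ->
  {morph f : h / opp G h >-> opp G' h} ->
  [/\ {morph f : h / fnext G h >-> fnext G' h},
      #|vertices G| = #|vertices G'|, #|faces G| = #|faces G'|,
      #|edges G| = #|edges G'| & #|dangling G| = #|dangling G'|].
Proof.
move=> bf fr fo.
have ff : {morph f : h / fnext G h >-> fnext G' h}.
  by move=> h; apply/esym/fnext_eq; rewrite -fr rot_fnext fo.
have fd h : (f h \in dangling G') = (h \in dangling G).
  by rewrite !inE -fo (inj_eq (bij_inj bf)).
have [f' fK f'K] := bf; have f_inj := can_inj fK.
have image_f (A : {set G}) (A' : {set G'}) :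
    (forall h, (f h \in A') = (h \in A)) -> f @: A = A'.
  move=> fA; apply/setP => y; apply/imsetP/idP => [[x xA ->]|yA]; first by rewrite fA.
  by exists (f' y); rewrite ?f'K // -fA f'K.
split; try exact: (card_porbits_bij bf).
- exact: ff.
- rewrite -(card_imset _ (imset_inj f_inj)); congr #|pred_of_set _|.
  have fe h : f @: [set h; opp G h] = [set f h; opp G' (f h)].
    by rewrite imsetU1 imset_set1 fo.
  apply/setP => Y; apply/imsetP/imsetP => [[_ /imsetP[h hd ->] ->]|[y yd ->]].
    by exists (f h); rewrite ?fe // in_setC fd -in_setC.
  exists [set f' y; opp G (f' y)]; last by rewrite fe f'K.
  by apply/imsetP; exists (f' y); rewrite // in_setC -fd f'K -in_setC.
by rewrite -(image_f _ _ fd) card_imset.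
Qed.

Section Heights.

Variable T : mobile_data.

Definition opens : {set T} := black T :\: dangling T.

Lemma disj_opens : [disjoint opens & dangling T].
Proof. by rewrite -setI_eq0; apply/eqP/setP => x; rewrite !inE; case: eqP; rewrite ?andbF. Qed.

Definition climbs : T -> nat -> bool := rises (fnext T) opens (dangling T).

End Heights.

Lemma iso_rises (X X' : finType) (s : {perm X}) (s' : {perm X'})
    (P N : {set X}) (P' N' : {set X'}) (f : X -> X') :
  {morph f : x / s x >-> s' x} ->
  (forall x, (f x \in P') = (x \in P)) -> (forall x, (f x \in N') = (x \in N)) ->
  forall x n, (rises s' P' N' (f x) n = rises s P N x n) *
              ((s' ^+ n) (f x) = f ((s ^+ n) x)).
Proof.
move=> fs fP fN.
have fsn x n : (s' ^+ n) (f x) = f ((s ^+ n) x) by symmetry; apply: perm_iter_morph.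
have fg x n : gain s' P' N' (f x) n = gain s P N x n.
  by apply: eq_bigr => i _; rewrite fsn /weight fP fN.
move=> x n; split=> //; rewrite /rises fg; congr [&& _, _ & _].
by apply: eq_forallb => j; rewrite fg.
Qed.

(** * Half-edges of the image of an orientation *)

Section Slots.

Variable O : omap.

Hypothesis or_out : orientation O.
Hypothesis has_out : every_vertex_has_outgoing O.
Hypothesis root_is_face : root_face O \in faces O.
Hypothesis root_not_out : forall h, h \in root_face O -> h \notin out O.

Local Notation T := (Phi_plus O).
Implicit Types (h e : O) (x y : T).

Lemma root_fnext h : (fnext O h \in root_face O) = (h \in root_face O).
Proof.
case/imsetP: root_is_face => r _ ->.
by rewrite -!eq_porbit_mem -{1}(perm_iter1 (fnext O) h) porbit_perm.
Qed.

Lemma root_opp_rot h : (opp O (rot O h) \in root_face O) = (h \in root_face O).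
Proof. by rewrite -[in RHS](fnext_opp_rot h) root_fnext. Qed.

Lemma out_notin_root h : h \in out O -> h \notin root_face O.
Proof. by apply: contraTN => /root_not_out. Qed.

(** The exponent is positive even if [h] is itself outgoing: the walk can always
    make a full turn around the vertex. *)
Lemma next_out h : exists k, (rot O ^+ k.+1) h \in out O.
Proof.
have [|h' /porbitP[i ->] iO] := has_out (X := porbit (rot O) h).
  by rewrite imset_f.
by exists (i + #[rot O].-1)%N; rewrite -addnS prednK // perm_iterD expg_order perm1.
Qed.

Lemma slot_iterl n h :
  (perm (@slot_rot_inj O) ^+ n) (inl h) = inl ((rot O ^+ n) h).
Proof.
elim: n => [|n IH]; first by rewrite !perm_iter0.
by rewrite !perm_iterS IH permE.
Qed.

Lemma white_slot h : h \in out O -> exists x, val x = inl h.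
Proof.
move=> ho; have hs : inl h \in slots O by rewrite inE ho out_notin_root.
by exists (exist (fun z => z \in slots O) _ hs).
Qed.

Lemma black_slot h : h \notin root_face O -> exists x, val x = inr h.
Proof.
move=> hR; have hs : inr h \in slots O by rewrite inE.
by exists (exist (fun z => z \in slots O) _ hs).
Qed.

Lemma slot_black x h : val x = inr h -> h \notin root_face O.
Proof. by move=> e; have := valP x; rewrite e inE. Qed.

Lemma slot_white x h : val x = inl h -> h \in out O.
Proof. by move=> e; have := valP x; rewrite e inE => /andP[]. Qed.

Lemma slot_oppE x : val (opp T x) = slot_opp (val x).
Proof. by rewrite /= permE. Qed.

Lemma opp_white x h : val x = inl h -> val (opp T x) = inr h.
Proof. by rewrite slot_oppE => ->. Qed.

Lemma opp_black x h : val x = inr h -> h \in out O -> val (opp T x) = inl h.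
Proof. by rewrite slot_oppE => -> /= ->. Qed.

Lemma opp_bud x h : val x = inr h -> h \notin out O -> opp T x = x.
Proof. by move=> e /negPf ho; apply: val_inj; rewrite slot_oppE e /= ho. Qed.

(** The root-face being a whole contour, erasing its half-edges does not affect
    the rotation around the other black vertices. *)
Lemma rot_black x h : val x = inr h -> val (rot T x) = inr (fnext O h).
Proof.
move=> e; have hR := slot_black e.
have [y ey] : exists y, val y = inr (fnext O h).
  by apply: black_slot; rewrite root_fnext.
rewrite -ey; congr val; apply: (@induced_perm_eq _ _ _ x y 0).
  by case=> [|j] /andP[].
by rewrite perm_iter1 permE ey e.
Qed.

Lemma rot_white x h : val x = inl h ->
  exists k, val (rot T x) = inl ((rot O ^+ k.+1) h) /\
    forall j, (0 < j < k.+1)%N -> (rot O ^+ j) h \notin out O.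
Proof.
move=> e; have [k [def_k no]] := induced_permP (perm (@slot_rot_inj O)) x.
exists k; rewrite [LHS]def_k e slot_iterl; split=> // j /no.
by rewrite e slot_iterl inE negb_and negbK => /orP[//|]; apply: root_not_out.
Qed.

Lemma mem_black x : (x \in black T) = if val x is inr _ then true else false.
Proof. by rewrite inE. Qed.

Lemma mem_dangling x :
  (x \in dangling T) = if val x is inr h then h \notin out O else false.
Proof.
rewrite inE -val_eqE slot_oppE; case: (val x) => h //=.
by case: ifP => // _; rewrite eqxx.
Qed.

Lemma mem_opens x :
  (x \in opens T) = if val x is inr h then h \in out O else false.
Proof.
rewrite inE mem_dangling mem_black; case: (val x) => h //.
by rewrite negbK andbT.
Qed.

Lemma fnext_bud x h : val x = inr h -> h \notin out O ->
  val (fnext T x) = inr (opp O (rot O h)).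
Proof.
move=> e ho; have [|y ey] := @black_slot (opp O (rot O h)).
  by rewrite root_opp_rot (slot_black e).
rewrite -ey; congr val; apply: (@fnext_eq T).
by apply: val_inj; rewrite (rot_black ey) fnext_opp_rot (opp_bud e ho) e.
Qed.

Lemma fnext_white x h : val x = inl h ->
  val (fnext T x) = inr (opp O (rot O h)).
Proof.
move=> e; have [|y ey] := @black_slot (opp O (rot O h)).
  by rewrite root_opp_rot out_notin_root // (slot_white e).
rewrite -ey; congr val; apply: (@fnext_eq T).
by apply: val_inj; rewrite (rot_black ey) fnext_opp_rot (opp_white e).
Qed.

Lemma fnext_open x h : val x = inr h -> h \in out O ->
  exists p k, [/\ val (fnext T x) = inl p, h = (rot O ^+ k.+1) p &
    forall j, (0 < j < k.+1)%N -> (rot O ^+ j) p \notin out O].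
Proof.
move=> e ho; case ey: (val (fnext T x)) => [p|q].
  have [k [def_k no]] := rot_white ey; exists p, k; split=> //.
  by move: def_k; rewrite rot_fnext (opp_black e ho) => -[].
by have := rot_black ey; rewrite rot_fnext (opp_black e ho).
Qed.

Lemma phi_colored : properly_colored T.
Proof.
split=> x.
  rewrite !mem_black; case e: (val x) => [h|h]; last by rewrite (rot_black e).
  by have [k [-> _]] := rot_white e.
rewrite mem_dangling !mem_black slot_oppE; case: (val x) => h //=.
by rewrite negbK => ->.
Qed.

Lemma phi_dangling_black : dangling T \subset black T.
Proof. by apply/subsetP => x; rewrite mem_dangling mem_black; case: (val x). Qed.

Lemma card_slots (A : {set T}) (B : {set O + O}) :
  B \subset slots O -> (forall x, (x \in A) = (val x \in B)) -> #|A| = #|B|.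
Proof.
move=> sB AB; rewrite -(card_imset _ val_inj); congr #|pred_of_set _|.
apply/setP => y; apply/imsetP/idP => [[x xA ->]|yB]; first by rewrite -AB.
by exists (Sub y (subsetP sB y yB)); rewrite ?AB.
Qed.

Lemma card_edges_orientation : #|edges O| = #|out O|.
Proof.
apply: card_edges => [|h _]; last exact: or_out.
rewrite -setI_eq0; apply/eqP/setP => h; rewrite !inE; apply/negP => /andP[ho /eqP e].
by have := or_out h; rewrite e ho.
Qed.

Lemma card_edges_phi : #|edges T| = #|out O|.
Proof.
rewrite (@card_edges T (~: black T)) => [|| x xd].
- rewrite (@card_slots _ (inl @: out O)); first by rewrite card_imset //; apply: inl_inj.
    apply/subsetP => _ /imsetP[h ho ->].
    by rewrite inE ho out_notin_root.
  move=> x; rewrite in_setC mem_black; case e: (val x) => [h|h].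
    by rewrite mem_imset ?(slot_white e) //; apply: inl_inj.
  by symmetry; apply/imsetP => -[].
- by rewrite disjoints_subset setCS phi_dangling_black.
by rewrite !in_setC; have [_ ->] := phi_colored.
Qed.

Lemma card_buds_phi : #|dangling T| = (#|out O| - #|root_face O|)%N.
Proof.
have -> : #|out O| = #|~: out O|.
  rewrite -(card_imset _ (@oppr_inj O)); congr #|pred_of_set _|.
  apply/setP => h; rewrite inE -or_out; apply/imsetP/idP => [[k ko ->]|ho].
    by rewrite oppK.
  by exists (opp O h); rewrite ?oppK.
rewrite -cardsDS; last first.
  by apply/subsetP => h /root_not_out; rewrite inE.
rewrite -(card_imset (~: out O :\: root_face O) (@inr_inj O O)).
apply: (@card_slots (dangling T)) => [|x].
  apply/subsetP => z /imsetP[h]; rewrite in_setD in_setC => /andP[hR _] ->.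
  by rewrite inE.
rewrite mem_dangling; case e: (val x) => [h|h].
  by symmetry; apply/imsetP => -[].
by rewrite mem_imset ?inE ?(slot_black e) //; apply: inr_inj.
Qed.

Lemma card_root_le : (#|root_face O| <= #|out O|)%N.
Proof.
rewrite -(card_imset _ (@oppr_inj O)); apply: subset_leq_card.
by apply/subsetP => _ /imsetP[h /root_not_out hR ->]; rewrite or_out.
Qed.

Lemma excess_phi : excess T = Posz #|root_face O|.
Proof.
by rewrite /excess card_edges_phi card_buds_phi; have := card_root_le; lia.
Qed.

Lemma slot_iterr n h :
  (perm (@slot_rot_inj O) ^+ n) (inr h) = inr ((fnext O ^+ n) h).
Proof.
elim: n => [|n IH]; first by rewrite !perm_iter0.
by rewrite !perm_iterS IH permE.
Qed.

(** The vertices of the mobile are those of the map, none of which is lost since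
    each has an outgoing half-edge, and the faces other than the root-face. *)
Lemma card_vertices_phi : (#|vertices T|.+1 = #|vertices O| + #|faces O|)%N.
Proof.
have orbl h : porbit (perm (@slot_rot_inj O)) (inl h) = inl @: porbit (rot O) h.
  apply/setP => y; apply/porbitP/imsetP => [[i ->]|[_ /porbitP[i ->] ->]].
    by exists ((rot O ^+ i) h); rewrite ?mem_porbit ?slot_iterl.
  by exists i; rewrite slot_iterl.
have orbr h : porbit (perm (@slot_rot_inj O)) (inr h) = inr @: porbit (fnext O) h.
  apply/setP => y; apply/porbitP/imsetP => [[i ->]|[_ /porbitP[i ->] ->]].
    by exists ((fnext O ^+ i) h); rewrite ?mem_porbit ?slot_iterr.
  by exists i; rewrite slot_iterr.
rewrite /vertices card_porbits_induced.
have -> : [set X in porbits (perm (@slot_rot_inj O)) | X :&: slots O != set0] =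
    [set inl @: X | X : {set O} in vertices O]
    :|: [set inr @: X | X : {set O} in faces O :\ root_face O].
  apply/setP => Y; rewrite !inE; apply/andP/orP.
    case=> /imsetP[[h|h] _ ->] /set0Pn[z]; rewrite inE => /andP[].
      rewrite orbl => _ _; left; apply/imsetP; exists (porbit (rot O) h) => //.
      exact: imset_f.
    rewrite orbr => /imsetP[k kh ->]; rewrite inE => kR; right.
    apply/imsetP; exists (porbit (fnext O) h) => //.
    rewrite !inE imset_f // andbT; apply: contraNneq kR => <-; exact: kh.
  case=> /imsetP[X]; rewrite ?inE.
    move=> XV ->; have [h hX ho] := has_out XV; split.
      case/imsetP: XV => k _ ->; rewrite -orbl; exact: imset_f.
    apply/set0Pn; exists (inl h); rewrite !inE ho out_notin_root // !andbT.
    exact: imset_f.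
  case/andP=> XR /imsetP[h _ eX] ->; rewrite eX -orbr; split; first exact: imset_f.
  apply/set0Pn; exists (inr h); rewrite !inE porbit_id /=.
  apply: contra XR => hR; rewrite eX; move: hR.
  by case/imsetP: root_is_face => r _ ->; rewrite -eq_porbit_mem.
rewrite (cardsD1 (root_face O) (faces O)) root_is_face add1n addnS cardsU.
have -> : [set inl @: X | X : {set O} in vertices O]
    :&: [set inr @: X | X : {set O} in faces O :\ root_face O] = set0
    :> {set {set O + O}}.
  apply/setP => Y; rewrite !inE; apply/negP => /andP[/imsetP[X XV ->]].
  have [h hX _] := has_out XV; case/imsetP => Z _ /setP/(_ (inl h)).
  by rewrite imset_f // => /esym/imsetP[].
have inj_l := imset_inj (@inl_inj O O); have inj_r := imset_inj (@inr_inj O O).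
by rewrite cards0 subn0 (card_imset _ inj_l) (card_imset _ inj_r).
Qed.

Lemma genus_phi g : #|faces T| = 1%N -> (has_genus T g <-> has_genus O g).
Proof.
move=> f1; rewrite /has_genus card_edges_phi card_edges_orientation f1.
by have := card_vertices_phi; lia.
Qed.

End Slots.

(** * Rightmost walks and rises *)

Section RightmostSteps.

Variable O : omap.
Implicit Types (h e : O).

Lemma rightmost_step_fun e a b : rightmost_step e a -> rightmost_step e b -> a = b.
Proof.
case=> i [-> iO noi] [j [-> jO noj]].
by rewrite (first_visit_uniq iO noi jO noj).
Qed.

Hypothesis or_out : orientation O.

Section RootStep.

Hypothesis root_is_face : root_face O \in faces O.
Hypothesis root_not_out : forall h, h \in root_face O -> h \notin out O.

(** The half-edges of the root-face being ingoing, the rightmost turn at the end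
    of an edge of its contour keeps to this contour. *)
Lemma root_step e : opp O e \in root_face O ->
  rightmost_step e (rot O (opp O e)) /\
  opp O (rot O (opp O e)) \in root_face O.
Proof.
move=> eR; have R' : opp O (rot O (opp O e)) \in root_face O.
  by rewrite (root_opp_rot root_is_face).
split=> //; exists 0; split; first by rewrite perm_iter1.
  by have := root_not_out R'; rewrite or_out negbK.
by case=> [|j] /andP[].
Qed.

End RootStep.

Hypothesis has_out : every_vertex_has_outgoing O.

Lemma rightmost_ex e : exists e', rightmost_step e e'.
Proof.
have ex := next_out has_out (opp O e).
case: (ex_minnP ex) => k kO min_k.
exists ((rot O ^+ k.+1) (opp O e)), k; split=> // -[//|j] /= lt_j.
by apply/negP => /min_k; rewrite leqNgt -ltnS lt_j.
Qed.

Lemma rightmost_fun : exists r : O -> O, forall e, rightmost_step e (r e).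
Proof. exact: fin_all_exists rightmost_ex. Qed.

End RightmostSteps.

Section RightRoot.

Variable O : omap.
Hypothesis root_is_face : root_face O \in faces O.
Hypothesis right : right_orientation O.
Implicit Types (h e : O).

Local Notation T := (Phi_plus O).

Lemma right_or : orientation O. Proof. by case: right. Qed.

Lemma right_has_out : every_vertex_has_outgoing O. Proof. by case: right. Qed.

Lemma rightmost_reaches_root (r : O -> O) (e : O) :
  (forall k, rightmost_step k (r k)) -> e \in out O ->
  exists N, opp O (iter N r e) \in root_face O /\
    forall k, iter (N + k) r e = ((opp O * rot O) ^+ k) (iter N r e).
Proof.
move=> rP eO; case: right => _ _ loops.
have [|N hN hk] := loops e eO (fun n => iter n r e).
  by split=> // n; rewrite iterS.
by exists N.
Qed.

(** Any rightmost walk ends up going around the whole contour, along the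
    opposites of the half-edges of the root-face. *)
Lemma right_root_not_out h : h \in root_face O -> h \notin out O.
Proof.
have [r rP] := rightmost_fun right_has_out.
move=> hR; have [e eO] : exists e, e \in out O.
  case ho: (h \in out O); first by exists h.
  by exists (opp O h); rewrite right_or ho.
have [N [NR walk]] := rightmost_reaches_root rP eO.
have walk_out n : iter n r e \in out O.
  by case: n => // n; rewrite iterS; have [? []] := rP (iter n r e).
(* Seen from the opposite half-edges, the walk follows the root contour
   backwards. *)
have oppwalk k : opp O (((opp O * rot O) ^+ k) (iter N r e))
    = ((fnext O)^-1 ^+ k) (opp O (iter N r e)).
  elim: k => [|k IH]; first by rewrite !perm_iter0.
  by rewrite !perm_iterS -IH permM fnextVE.
have : h \in porbit (fnext O)^-1 (opp O (iter N r e)).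
  rewrite porbitV; case/imsetP: root_is_face hR NR => f _ -> hf.
  by rewrite -eq_porbit_mem => /eqP ->.
by case/porbitP=> k ->; rewrite -oppwalk -walk right_or walk_out.
Qed.

Local Notation or_out := right_or.
Local Notation has_out := right_has_out.
Local Notation root_not_out := right_root_not_out.
Local Notation root_step := (root_step or_out root_is_face root_not_out).

(** All the walks have reached the root contour after a common number of steps,
    since they cannot leave it. *)
Lemma root_reached : exists2 r : O -> O, (forall k, rightmost_step k (r k)) &
  exists K, forall e, e \in out O -> opp O (iter K r e) \in root_face O.
Proof.
have [r rP] := rightmost_fun has_out; exists r => //.
have root_iter n e : opp O e \in root_face O -> opp O (iter n r e) \in root_face O.
  move=> eR; elim: n => // n IH; rewrite iterS.
  have [st R'] := root_step IH.
  by rewrite (rightmost_step_fun (rP _) st).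
have [f hf] : exists f : O -> nat, forall e, e \in out O ->
    opp O (iter (f e) r e) \in root_face O.
  apply: (@fin_all_exists _ (fun _ => nat)
            (fun e n => e \in out O -> opp O (iter n r e) \in root_face O)) => e.
  case eO: (e \in out O); last by exists 0.
  by have [N [NR _]] := rightmost_reaches_root rP eO; exists N.
exists (\max_e f e) => e eO.
have le : (f e <= \max_e f e)%N by apply: leq_bigmax.
by rewrite -(subnK le) iterD root_iter // hf.
Qed.

(** This compares half-edges of the map through their copies at black vertices:
    the copy of an outgoing half-edge is an opening, the other ones are buds. *)
Definition Rise (a b : O) : Prop :=
  exists (x : T) n, [/\ val x = inr a, climbs x n & val ((fnext T ^+ n) x) = inr b].

Lemma black_inj (x y : T) h : val x = inr h -> val y = inr h -> x = y.
Proof. by move=> ex ey; apply: val_inj; rewrite ex. Qed.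

Lemma Rise_uniq a b c : Rise a c -> Rise b c -> a = b.
Proof.
move=> [x [n [ex rx hx]]] [y [m [ey ry hy]]].
have [|_ e] := rises_uniq rx ry; first exact: black_inj hx hy.
by move: ey; rewrite -e ex => -[].
Qed.

Lemma Rise_match_trans a b : Rise a b -> Rise b (opp O b) ->
  opp O b \notin out O -> Rise a (opp O (rot O (opp O b))).
Proof.
move=> [x [n [ex rx hx]]] [y [m [ey ry hy]]] bO.
have {ey} ey : (fnext T ^+ n) x = y := black_inj hx ey.
have hyN : (fnext T ^+ m) y \in dangling T by rewrite mem_dangling hy.
have := rises_excursion (disj_opens T) rx; rewrite ey => /(_ m ry).
rewrite perm_iterD ey => /(_ hyN) r.
exists x, (n + m).+1; split=> //.
by rewrite perm_iterS perm_iterD ey (fnext_bud root_is_face hy).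
Qed.

(** From the opening of [e], the contour of the mobile passes along the white
    side of [p], the outgoing half-edge before [e], to the copy of the opposite
    of [rot O p].  If [rot O p] is not [e], it is the end of an edge [k]
    whose next edge on the rightmost walk is [e]; after the excursion of [k],
    which ends at the bud of [k], the contour comes to the copy of the opposite
    of the next half-edge around the vertex, and so on until it turns up at the
    bud of [e], or at an edge of the root contour. *)
Lemma Rise_chain e p m :
  e \in out O -> e = (rot O ^+ m.+1) p -> p \in out O ->
  (forall j, (0 < j < m.+1)%N -> (rot O ^+ j) p \notin out O) ->
  (forall k, k \in out O -> rightmost_step k e -> opp O k \notin root_face O ->
     Rise k (opp O k)) ->
  forall j, (j < m.+1)%N ->
  (forall i, (0 < i <= j)%N -> (rot O ^+ i) p \notin root_face O) ->
  Rise e (opp O ((rot O ^+ j.+1) p)).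
Proof.
move=> eO def_e pO no match_k; elim=> [_ _|j IH lt_jm notR].
  have [x ex] := black_slot (out_notin_root root_not_out eO).
  have xP : x \in opens T by rewrite mem_opens ex.
  have r1 := rises1 (fnext T) (disj_opens T) xP.
  have [p' [k [ey def_e' no']]] := fnext_open root_is_face root_not_out ex eO.
  have p'O := slot_white ey.
  have ep : p' = p := last_visit_uniq (etrans (esym def_e') def_e) p'O pO no' no.
  rewrite ep in ey; exists x, 2; split=> //.
    apply: (rises_neutral r1); rewrite perm_iter1.
      by rewrite mem_opens ey.
    by rewrite mem_dangling ey.
  by rewrite perm_iterS perm_iter1 (fnext_white root_is_face root_not_out ey) perm_iter1.
have {}IH : Rise e (opp O ((rot O ^+ j.+1) p)).
  apply: IH; first exact: ltnW.
  by move=> i /andP[i0 le_i]; apply: notR; rewrite i0 leqW.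
have jO : (rot O ^+ j.+1) p \notin out O by apply: no.
have jR : (rot O ^+ j.+1) p \notin root_face O by apply: notR; rewrite /= leqnn.
rewrite (perm_iterS _ j.+1) -{1}(oppK ((rot O ^+ j.+1) p)).
apply: Rise_match_trans => //; last by rewrite oppK.
apply: match_k; rewrite ?oppK ?or_out //.
exists (m - j.+1)%N; rewrite oppK -perm_iterD; split=> //.
  by rewrite def_e; congr ((rot O ^+ _) p); lia.
move=> i hi; rewrite -perm_iterD; apply: no; lia.
Qed.

Lemma prev_out e : e \in out O -> exists p m,
  [/\ e = (rot O ^+ m.+1) p, p \in out O &
      forall j, (0 < j < m.+1)%N -> (rot O ^+ j) p \notin out O].
Proof.
move=> eO; have [x ex] := black_slot (out_notin_root root_not_out eO).
have [p [m [ey def_e no]]] := fnext_open root_is_face root_not_out ex eO.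
by exists p, m; split=> //; exact: slot_white ey.
Qed.

(** If [e] follows [k] on a rightmost walk, no outgoing half-edge separates the
    end of [k] from [e], so that [k] ends between [p] and [e]. *)
Lemma step_position e k p m : rightmost_step k e -> e \in out O -> k \in out O ->
  e = (rot O ^+ m.+1) p -> p \in out O ->
  (forall j, (0 < j < m.+1)%N -> (rot O ^+ j) p \notin out O) ->
  exists2 i, (0 < i <= m)%N & opp O k = (rot O ^+ i) p.
Proof.
move=> [j [def_e _ noj]] eO kO def_e' pO no.
have kO' : opp O k \notin out O by rewrite or_out kO.
case: (ltnP j m) => [lt_jm|le_mj].
  exists (m - j)%N; first lia.
  symmetry; have := @perm_iter_sub _ (rot O) j.+1 m.+1 p (opp O k).
  by rewrite subSS; apply; rewrite -?def_e // ltnW.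
have ep : (rot O ^+ (j - m)) (opp O k) = p.
  have := @perm_iter_sub _ (rot O) m.+1 j.+1 (opp O k) p.
  by rewrite subSS; apply; rewrite -?def_e.
have [j_m|j_m] := posnP (j - m)%N.
  by move: ep; rewrite j_m perm_iter0 => ep; rewrite ep pO in kO'.
by have := noj (j - m)%N; rewrite ep pO; case: ltnP => //; lia.
Qed.

(** After a half-edge of the root-face comes an outgoing one, and there is none
    between [p] and [e]. *)
Lemma not_root_before e p m : e = (rot O ^+ m.+1) p ->
  (forall j, (0 < j < m.+1)%N -> (rot O ^+ j) p \notin out O) ->
  forall i, (0 < i < m)%N -> (rot O ^+ i) p \notin root_face O.
Proof.
move=> def_e no i hi; apply/negP => iR.
have := root_not_out (h := opp O (rot O ((rot O ^+ i) p))).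
rewrite (root_opp_rot root_is_face) => /(_ iR).
by rewrite or_out negbK -perm_iterS; apply/negP/no; lia.
Qed.

(** Induction from the leaves to the root of the tree of rightmost walks, in the
    form: no walk of [n] steps ends at [e].  For some [n] this holds outside the
    root contour, where all the walks have arrived by then; and it passes to
    the edges from which a step leads to [e], with one step less. *)
Lemma Rise_match e : e \in out O -> opp O e \notin root_face O -> Rise e (opp O e).
Proof.
have [r rP [K hK]] := root_reached.
have : forall k, k \in out O -> opp O e \notin root_face O -> iter K r k <> e.
  by move=> k /hK kR /negP eR ek; rewrite ek in kR.
elim: K {hK} e => [|n IH] e none eO eR; first by case: (none e eO eR).
have [p [m [def_e pO no]]] := prev_out eO.
rewrite {2}def_e.
apply: (Rise_chain eO def_e pO no) => [k kO ke kR|//|i /andP[i0]].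
  apply: IH => // k' k'O _ ek; apply: (none k' k'O eR).
  by rewrite iterS ek; apply: rightmost_step_fun (rP k) ke.
rewrite leq_eqVlt => /orP[/eqP->|lt_im].
  by apply: contra eR; rewrite def_e perm_iterS (root_opp_rot root_is_face).
by apply: not_root_before def_e no _ _; rewrite i0.
Qed.

(** The edge [k] is met on the way in [Rise_chain]. *)
Lemma Rise_step k e : k \in out O -> rightmost_step k e -> Rise e k.
Proof.
move=> kO ke; have eO : e \in out O by case: ke => j [].
have [p [m [def_e pO no]]] := prev_out eO.
have [i /andP[i0 le_im] ei] := step_position ke eO kO def_e pO no.
rewrite -(oppK k) ei -(prednK i0).
apply: (Rise_chain eO def_e pO no) => [k' k'O _ k'R||j hj].
- exact: Rise_match.
- lia.
by apply: not_root_before def_e no _ _; lia.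
Qed.

(** By [Rise_step] and [Rise_match], the contour of the mobile that visits an
    edge visits the next one on the rightmost walk and the bud of its right side;
    all the contours therefore meet on the root contour. *)
Lemma right_single_cycle (x : T) : porbit (fnext T) x = [set: T].
Proof.
have [r rP [K hK]] := root_reached.
have r_out e : r e \in out O by have [? []] := rP e.
have orbR a b (y z : T) : Rise a b -> val y = inr a -> val z = inr b ->
    porbit (fnext T) y = porbit (fnext T) z.
  case=> [y' [n [ey _ hz]]] /(black_inj ey) <- /(black_inj hz) <-.
  by rewrite porbit_perm.
have orb_iter n e (y z : T) : e \in out O -> val y = inr e -> val z = inr (iter n r e) ->
    porbit (fnext T) y = porbit (fnext T) z.
  move=> eO; elim: n z => [|n IH] z ey ez; first by rewrite (black_inj ey ez).
  have nO : iter n r e \in out O by case: (n) => // n'; rewrite iterS.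
  have [t et] := black_slot (out_notin_root root_not_out nO).
  rewrite (IH t ey et); symmetry; apply: orbR ez et.
  exact: Rise_step.
have root_same e e' (y z : T) : opp O e \in root_face O -> opp O e' \in root_face O ->
    val y = inr e -> val z = inr e' -> porbit (fnext T) y = porbit (fnext T) z.
  move=> eR e'R; have : opp O e' \in porbit (fnext O)^-1 (opp O e).
    rewrite porbitV; case/imsetP: root_is_face e'R eR => f _ -> hf.
    by rewrite -eq_porbit_mem => /eqP ->.
  case/porbitP=> n; elim: n e eR y => [|n IH] e eR y.
    by rewrite perm_iter0 => /oppr_inj -> /black_inj ey /ey ->.
  rewrite perm_iterSr fnextVE => en ey ez; have [st R'] := root_step eR.
  have R'O : opp O (opp O (rot O (opp O e))) \in out O.
    by rewrite or_out root_not_out.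
  rewrite oppK in R'O.
  have [t et] := black_slot (out_notin_root root_not_out R'O).
  rewrite -(IH _ R' t) //; symmetry; apply: orbR et ey.
  apply: Rise_step st; have := root_not_out eR; by rewrite or_out negbK.
have all_open e e' (y z : T) : e \in out O -> e' \in out O ->
    val y = inr e -> val z = inr e' -> porbit (fnext T) y = porbit (fnext T) z.
  move=> eO e'O ey ez.
  have iO f : f \in out O -> iter K r f \in out O.
    by move=> fO; case: (K) => // n; rewrite iterS.
  have [t et] := black_slot (out_notin_root root_not_out (iO e eO)).
  have [u eu] := black_slot (out_notin_root root_not_out (iO e' e'O)).
  rewrite (orb_iter K e y t) // (orb_iter K e' z u) //.
  exact: root_same (hK _ eO) (hK _ e'O) et eu.
have to_open (y : T) : exists e (z : T), [/\ e \in out O, val z = inr e &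
    porbit (fnext T) y = porbit (fnext T) z].
  have step (z : T) : porbit (fnext T) (fnext T z) = porbit (fnext T) z.
    by rewrite -{1}(perm_iter1 (fnext T)) porbit_perm.
  have black (z : T) h : val z = inr h -> exists e (u : T),
      [/\ e \in out O, val u = inr e & porbit (fnext T) z = porbit (fnext T) u].
    move=> ez; have [hO|hO] := boolP (h \in out O); first by exists h, z.
    have eO : opp O h \in out O by rewrite or_out.
    have [u eu] := black_slot (out_notin_root root_not_out eO).
    exists (opp O h), u; split=> //; symmetry; apply: (orbR _ _ _ _ _ eu ez).
    by have := Rise_match eO; rewrite oppK; apply; exact: slot_black ez.
  case ey: (val y) => [h|h]; last exact: black ey.
  have [e [u [eO eu e_u]]] := black _ _ (fnext_white root_is_face root_not_out ey).
  by exists e, u; rewrite -e_u step.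
apply/setP => y; rewrite inE -eq_porbit_mem.
have [e [u [eO eu ->]]] := to_open x; have [e' [u' [e'O eu' ->]]] := to_open y.
exact/eqP/all_open/eu/eu'.
Qed.

End RightRoot.

Lemma right_orientation_mobile d g (O : omap) : (0 < d)%N ->
  right_orientations d g O -> mobiles d g (Phi_plus O).
Proof.
move=> d0 [[[conn gen] nodang rf] cR right].
have oro := right_or right; have hout := right_has_out right.
have rno := right_root_not_out rf right.
have [h hR] : exists h, h \in root_face O.
  by apply/set0Pn; rewrite -card_gt0 cR.
have ho : opp O h \in out O by rewrite oro rno.
have [x _] := black_slot (out_notin_root rno ho).
have cyc := right_single_cycle rf right.
have f1 : #|faces (Phi_plus O)| = 1%N.
  apply/eqP/cards1P; exists [set: Phi_plus O]; apply/setP => Y; rewrite inE.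
  apply/imsetP/eqP => [[y _ ->]|->]; first exact: cyc.
  by exists x => //; rewrite cyc.
split; last by rewrite (excess_phi oro rf rno) cR.
split=> //.
- split; first exact: one_face_connected (cyc x).
  by apply/(genus_phi oro hout rf rno g f1).
- exact: phi_colored.
exact: phi_dangling_black.
Qed.

(** * Isomorphisms between images *)

Definition sum_map (A B : Type) (f : A -> B) (x : A + A) : B + B :=
  match x with inl a => inl (f a) | inr a => inr (f a) end.

Lemma slot_map (O O' : omap) (f : O -> O') :
  (forall h, (f h \in out O') = (h \in out O)) ->
  (forall h, (f h \in root_face O') = (h \in root_face O)) ->
  exists F : Phi_plus O -> Phi_plus O', forall x, val (F x) = sum_map f (val x).
Proof.
move=> fO fR.
have h (x : Phi_plus O) : sum_map f (val x) \in slots O'.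
  by case: x => [[h|h]] /=; rewrite !inE ?fO fR.
by exists (fun x => exist (fun z => z \in slots O') _ (h x)).
Qed.

Lemma omap_iso_phi (O O' : omap) :
  omap_iso O O' -> mobile_iso (Phi_plus O) (Phi_plus O').
Proof.
case=> f [[f' fK f'K] fr fo fO fR].
have ff : {morph f : h / fnext O h >-> fnext O' h}.
  by move=> h; apply/esym/fnext_eq; rewrite -fr rot_fnext fo.
have [F valF] := slot_map fO fR.
have [||F' valF'] := @slot_map O' O f'.
- by move=> h; rewrite -fO f'K.
- by move=> h; rewrite -fR f'K.
exists F; split.
- exists F' => x; apply: val_inj; rewrite !(valF, valF').
    by case: (val x) => h /=; rewrite fK.
  by case: (val x) => h /=; rewrite f'K.
- apply: (induced_perm_morph (f := sum_map f)) => [[h|h]|[h|h]|//].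
  + by rewrite !permE /= fr.
  + by rewrite !permE /= ff.
  + by rewrite !inE /= fO fR.
  + by rewrite !inE /= fR.
- move=> x; apply: val_inj; rewrite valF !slot_oppE valF.
  by case: (val x) => h //=; rewrite fO; case: ifP.
by move=> x; rewrite !mem_black valF; case: (val x).
Qed.

Section Injectivity.

Variables (O O' : omap).
Hypothesis face_root : root_face O \in faces O.
Hypothesis face_root' : root_face O' \in faces O'.
Hypothesis right : right_orientation O.
Hypothesis right' : right_orientation O'.

Variable F : Phi_plus O -> Phi_plus O'.
Hypothesis F_inj : injective F.
Hypothesis F_rot : {morph F : h / rot (Phi_plus O) h >-> rot (Phi_plus O') h}.
Hypothesis F_opp : {morph F : h / opp (Phi_plus O) h >-> opp (Phi_plus O') h}.
Hypothesis F_black : forall h, (F h \in black (Phi_plus O')) = (h \in black (Phi_plus O)).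

Hypothesis card_le : (#|O'| <= #|O|)%N.

Local Notation no_out := (right_root_not_out face_root right).
Local Notation no_out' := (right_root_not_out face_root' right').

Local Notation S := (Phi_plus O).
Local Notation S' := (Phi_plus O').

Lemma F_fnext : {morph F : x / fnext S x >-> fnext S' x}.
Proof. by move=> x; apply/esym/fnext_eq; rewrite -F_rot rot_fnext F_opp. Qed.

Lemma F_dangling x : (F x \in dangling S') = (x \in dangling S).
Proof. by rewrite !in_set -F_opp (inj_eq F_inj). Qed.

Lemma F_opens x : (F x \in opens S') = (x \in opens S).
Proof. by rewrite !in_setD F_dangling F_black. Qed.

Lemma black_image x h : val x = inr h -> exists u, val (F x) = inr u.
Proof.
move=> ex; have := F_black x; rewrite !mem_black ex.
by case: (val (F x)) => // u _; exists u.
Qed.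

(** The half-edges of the root-face have no counterpart in the mobile; their
    images are dictated by the opposite half-edges. *)
Lemma half_map_ex : exists f : O -> O', forall h,
  (h \notin root_face O -> forall x, val x = inr h -> val (F x) = inr (f h)) /\
  (h \in root_face O -> forall x, val x = inr (opp O h) ->
     val (F x) = inr (opp O' (f h))).
Proof.
pose P h u :=
  (h \notin root_face O -> forall x, val x = inr h -> val (F x) = inr u) /\
  (h \in root_face O -> forall x, val x = inr (opp O h) ->
     val (F x) = inr (opp O' u)).
apply: (@fin_all_exists _ (fun _ => O' : Type) P) => h.
have [hR|hR] := boolP (h \in root_face O).
  have hO : opp O h \in out O by rewrite (right_or right) no_out.
  have [x ex] := black_slot (out_notin_root no_out hO).
  have [u eu] := black_image ex; exists (opp O' u).
  split=> [|_ y ey]; first by rewrite hR.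
  by rewrite oppK (black_inj ey ex).
have [x ex] := black_slot hR; have [u eu] := black_image ex.
exists u; split=> [_ y ey|]; first by rewrite (black_inj ey ex).
by rewrite (negPf hR).
Qed.

(** [Rise_match] and [Rise_step] express the opposition and the contour of the
    root-face in terms of rises, which [F] preserves; as ends of rises
    determine their starts, the half-edges found in the second map are the
    images of those of the first. *)
Lemma phi_morph_iso : omap_iso O O'.
Proof.
have [f fP] := half_map_ex.
have or := right_or right; have or' := right_or right'.
have f_slot h x : val x = inr h -> val (F x) = inr (f h).
  by move=> ex; case: (fP h) => + _; apply=> //; apply: slot_black ex.
have f_notR h : h \notin root_face O -> f h \notin root_face O'.
  by move=> /black_slot[x /f_slot]; apply: slot_black.
have f_Rise a b : Rise a b -> Rise (f a) (f b).
  move=> [x [n [ex r ey]]]; exists (F x), n.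
  have := iso_rises F_fnext F_opens F_dangling x n.
  by rewrite /climbs => -[-> ->]; split=> //; apply: f_slot.
have f_out0 h : h \notin root_face O -> (f h \in out O') = (h \in out O).
  case/black_slot=> x ex; have := F_dangling x.
  by rewrite !mem_dangling ex (f_slot _ _ ex) => /negb_inj.
have f_root e : e \in out O -> opp O e \in root_face O ->
    f (opp O e) = opp O' (f e) /\ opp O' (f e) \in root_face O'.
  move=> eO eR; have [x ex] := black_slot (out_notin_root no_out eO).
  split.
    have [_ /(_ eR x)] := fP (opp O e); rewrite oppK => /(_ ex).
    by rewrite (f_slot _ _ ex) => -[->]; rewrite oppK.
  have feO : f e \in out O' by rewrite f_out0 ?(out_notin_root no_out eO).
  (* A bud matched with [f e] would come from a bud matched with [e]. *)
  apply/negPn/negP => /(Rise_match face_root' right' feO) [x' [n [ex' r ey']]].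
  have exx' : F x = x' by apply: black_inj ex'; exact: f_slot.
  have [er en] := iso_rises F_fnext F_opens F_dangling x n.
  rewrite -exx' /climbs er in r; rewrite -exx' en in ey'.
  have : (fnext S ^+ n) x \in dangling S.
    by rewrite -F_dangling mem_dangling ey' or' feO.
  rewrite mem_dangling; case ey: (val _) => [h|h] // hO.
  have hR : h \notin root_face O := slot_black ey.
  have /(Rise_match face_root right) : opp O h \in out O by rewrite or.
  rewrite oppK => /(_ hR) rh.
  have eh : e = opp O h by apply: Rise_uniq rh; exists x, n.
  by move: eR; rewrite eh oppK (negPf hR).
have f_opp_out e : e \in out O -> f (opp O e) = opp O' (f e).
  move=> eO; have [eR|eR] := boolP (opp O e \in root_face O).
    by have [] := f_root e eO eR.
  have := f_Rise _ _ (Rise_match face_root right eO eR).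
  set h' := f (opp O e) => r1.
  have h'O : opp O' h' \in out O'.
    by rewrite or' f_out0 // or eO.
  have := Rise_match face_root' right' h'O; rewrite oppK => /(_ (f_notR _ eR)) r2.
  by rewrite (Rise_uniq r1 r2) oppK.
have f_opp : {morph f : h / opp O h >-> opp O' h}.
  move=> h; have [hO|hO] := boolP (h \in out O); first exact: f_opp_out.
  by rewrite -[in RHS](oppK h) (f_opp_out (opp O h)) ?or // oppK.
have f_R h : (f h \in root_face O') = (h \in root_face O).
  apply/idP/idP => [|hR]; first by apply: contraTT; apply: f_notR.
  have hO : opp O h \in out O by rewrite or no_out.
  have [|_] := f_root _ hO; first by rewrite oppK.
  by rewrite -f_opp oppK.
have f_out h : (f h \in out O') = (h \in out O).
  have [hR|hR] := boolP (h \in root_face O); last exact: f_out0.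
  by rewrite (negPf (no_out hR)) (negPf (no_out' _)) // f_R.
have f_inj : injective f.
  have inj0 a b : a \notin root_face O -> b \notin root_face O -> f a = f b -> a = b.
    move=> /black_slot[x ex] /black_slot[y ey] e.
    have : F x = F y by apply: val_inj; rewrite (f_slot _ _ ex) (f_slot _ _ ey) e.
    by move/F_inj => exy; move: ey; rewrite -exy ex => -[].
  have injR h : h \in root_face O -> opp O h \notin root_face O.
    by move=> hR; apply: (out_notin_root no_out); rewrite or no_out.
  move=> a b e; have := f_R a; rewrite e f_R.
  have [bR|bR] := boolP (b \in root_face O) => /esym aR.
    apply/(@oppr_inj O)/inj0; rewrite ?injR //.
    by rewrite !f_opp e.
  by apply: inj0 => //; rewrite aR.
have f_fnext : {morph f : h / fnext O h >-> fnext O' h}.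
  move=> h; have [hR|hR] := boolP (h \in root_face O); last first.
    have [x ex] := black_slot hR.
    have := f_slot _ _ (rot_black face_root ex).
    by rewrite F_rot (rot_black face_root' (f_slot _ _ ex)) => -[].
  (* On the root contour, [k] leads to [opp O h] by a rightmost step.  The
     step from [f k] leads to the parent of [f k], which is [f (opp O h)]. *)
  pose k := opp O (fnext O h).
  have kR : opp O k \in root_face O by rewrite oppK (root_fnext face_root).
  have kO : k \in out O by have := no_out kR; rewrite or negbK.
  have [st _] := root_step or face_root no_out kR.
  rewrite oppK rot_fnext in st.
  have r1 := f_Rise _ _ (Rise_step face_root right kO st).
  have kR' : opp O' (f k) \in root_face O' by rewrite -f_opp f_R.
  have kO' : f k \in out O' by rewrite f_out.
  have [st' _] := root_step or' face_root' no_out' kR'.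
  have e := Rise_uniq r1 (Rise_step face_root' right' kO' st').
  apply/esym/fnext_eq; rewrite -f_opp e.
  by rewrite -f_opp oppK.
exists f; split=> //; first exact: inj_card_bij.
move=> h; rewrite !rotE f_opp; congr (opp O' _).
apply: (@perm_inj _ (fnext O')); by rewrite -f_fnext !permKV.
Qed.

End Injectivity.

Lemma card_half_orientation (O : omap) : orientation O -> #|O| = (#|out O| + #|out O|)%N.
Proof.
move=> or; rewrite -cardsT -(setUCr (out O)) cardsU setICr cards0 subn0.
congr (_ + _)%N; rewrite -(card_imset _ (@oppr_inj O)); congr #|pred_of_set _|.
apply/setP => h; apply/imsetP/idP => [[k]|ho].
  by rewrite inE => kO ->; rewrite or.
by exists (opp O h); rewrite ?oppK // inE or ho.
Qed.

(** As each edge has two halves in a map and one white half in the mobile,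
    isomorphic images come from maps with the same number of half-edges. *)
Lemma phi_iso_omap d g (O O' : omap) :
  right_orientations d g O -> right_orientations d g O' ->
  mobile_iso (Phi_plus O) (Phi_plus O') -> omap_iso O O'.
Proof.
move=> [[_ _ rf] _ ri] [[_ _ rf'] _ ri'] [F [bF Fr Fo Fb]].
apply: (phi_morph_iso rf rf' ri ri' (bij_inj bF) Fr Fo Fb).
have no := right_root_not_out rf ri; have no' := right_root_not_out rf' ri'.
have or := right_or ri; have or' := right_or ri'.
have [_ _ _ eE _] := iso_card bF Fr Fo.
by rewrite !card_half_orientation // -(card_edges_phi rf no) -(card_edges_phi rf' no') eE.
Qed.

(** * The closure of a mobile *)

Section Closure.

Variable T : mobile_data.

Local Notation s := (fnext T).
Local Notation pairs := (matched (fnext T) (opens T) (dangling T)).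

Definition free_opens : {set T} := unmatched s (opens T) (dangling T).

Lemma free_opens_open x : x \in free_opens -> x \in opens T.
Proof. by rewrite inE => /andP[]. Qed.

Lemma opens_black x : x \in opens T -> x \in black T.
Proof. by rewrite inE => /andP[]. Qed.

Local Notation BB := {x : T | x \in black T}.
Local Notation UU := {x : T | x \in free_opens}.

(** The half-edges on the contours of the inner faces, which are the black
    half-edges of the mobile, and those of the root-face. *)
Definition closure_half : finType := (BB + UU)%type.

(** An unmatched opening [u] gives the two half-edges of an edge of the root
    contour: [inl (free_black u)] on the left, and [inr u] in the root-face. *)
Definition free_black (u : UU) : BB :=
  exist (fun x => x \in black T) (val u) (opens_black (free_opens_open (valP u))).

Definition closure_fnext_fun (h : closure_half) : closure_half :=
  match h with
  | inl b => inl (induced_perm (rot T) (black T) b)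
  | inr u => inr (induced_perm s free_opens u)
  end.

Lemma closure_fnext_inj : injective closure_fnext_fun.
Proof. by move=> [x|x] [y|y] //= [] /perm_inj ->. Qed.

(** The matched pairs, in both directions: an opening and a bud are the two halves
    of a new edge. *)
Definition partner (x y : T) : bool := pairs x y || pairs y x.

(** The last case makes this an involution for every mobile, even if some bud has
    no match. *)
Definition closure_opp_fun (h : closure_half) : closure_half :=
  match h with
  | inl b => if [pick y : BB | partner (val b) (val y)] is Some y then inl y
             else if insub (val b) is Some u then inr u else inl b
  | inr u => inl (free_black u)
  end.

Lemma partner_sym x y : partner x y = partner y x.
Proof. by rewrite /partner orbC. Qed.

Lemma pairsP x y :
  reflect (exists2 n, climbs x n & (s ^+ n) x = y /\ y \in dangling T) (pairs x y).
Proof. exact: (matchedP _ (disj_opens T)). Qed.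

Lemma pairs_open x y : pairs x y -> x \in opens T.
Proof. exact: (matched_start (disj_opens T)). Qed.

Lemma open_notin_dangling x : x \in opens T -> x \notin dangling T.
Proof. by rewrite inE => /andP[]. Qed.

Lemma partner_fun x y z : partner x y -> partner x z -> y = z.
Proof.
have no a b c : pairs a b -> pairs c a -> False.
  by move=> /pairs_open/open_notin_dangling/negP na /matched_end.
case/orP=> h /orP[] h'; first exact: (matched_fun (disj_opens T) h h').
- by case: (no _ _ _ h h').
- by case: (no _ _ _ h' h).
exact: (matched_inj (disj_opens T) h h').
Qed.

Lemma free_no_partner x y : x \in free_opens -> partner x y = false.
Proof.
move=> xU; apply/negP => /orP[h|/matched_end xN].
  by move: xU; rewrite inE => /andP[_ /forallP/(_ y)]; rewrite h.
by have := open_notin_dangling (free_opens_open xU); rewrite xN.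
Qed.

Lemma closure_opp_partner (b y : BB) :
  partner (val b) (val y) -> closure_opp_fun (inl b) = inl y.
Proof.
move=> h /=; case: pickP => [z hz|/(_ y)]; last by rewrite h.
by congr inl; apply/val_inj/(partner_fun hz h).
Qed.

Lemma closure_opp_free (b : BB) (u : UU) :
  val b = val u -> closure_opp_fun (inl b) = inr u.
Proof.
move=> e /=; case: pickP => [z|_].
  by rewrite e free_no_partner // (valP u).
by rewrite e valK.
Qed.

Lemma closure_oppK0 : involutive closure_opp_fun.
Proof.
case=> [b|u]; last exact: closure_opp_free.
rewrite /closure_opp_fun -/closure_opp_fun; case: pickP => [y hy|no].
  by apply: closure_opp_partner; rewrite partner_sym.
case: insubP => [u _ e|nU]; first by congr inl; apply: val_inj.
case: pickP => [y|_]; first by rewrite no.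
by case: insubP nU => // u -> .
Qed.

Definition closure_opp : {perm closure_half} := perm (inv_inj closure_oppK0).

Lemma closure_oppK : involutive closure_opp.
Proof. by move=> h; rewrite !permE closure_oppK0. Qed.

(** The rotation is the one for which the contours are the cycles of
    [closure_fnext_fun]. *)
Definition closure_ribbon : ribbon :=
  {| half := closure_half;
     rot := (perm closure_fnext_inj)^-1 * closure_opp;
     opp := closure_opp;
     oppK := closure_oppK |}.

Definition closure_omap : omap :=
  {| obase := closure_ribbon;
     out := [set h : closure_ribbon |
              if h is inl b then val b \in opens T else false];
     root_face := [set h : closure_ribbon | if h is inr _ then true else false] |}.

Local Notation O := closure_omap.

Lemma closure_fnextE h : fnext O h = closure_fnext_fun h.
Proof.
rewrite fnextE; apply: (@perm_inj _ (rot O)); rewrite permKV /= permM.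
by rewrite -[closure_fnext_fun h](permE closure_fnext_inj) permK.
Qed.

Lemma closure_oppE h : opp O h = closure_opp_fun h.
Proof. by rewrite /= permE. Qed.

Lemma closure_outE h :
  (h \in out O) = if h is inl b then val b \in opens T else false.
Proof. by rewrite inE. Qed.

Lemma closure_rootE h : (h \in root_face O) = if h is inr _ then true else false.
Proof. by rewrite inE. Qed.

Lemma closure_root_not_out h : h \in root_face O -> h \notin out O.
Proof. by rewrite closure_rootE closure_outE; case: h. Qed.

Lemma closure_rot (b y : BB) : val y = rot T (val b) ->
  rot O (inl y) = opp O (inl b).
Proof.
move=> e; rewrite -[inl b]/(inl b : O) -rot_fnext; congr (rot O _).
rewrite closure_fnextE /=; congr inl; symmetry.
apply: (@induced_perm_eq _ _ _ b y 0); first by case=> [|j] /andP[].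
by rewrite perm_iter1.
Qed.

Hypothesis colored : properly_colored T.
Hypothesis buds_black : dangling T \subset black T.
Hypothesis one_cycle : forall x, porbit s x = [set: T].
Hypothesis more_opens : (#|dangling T| < #|opens T|)%N.

Lemma rot_colored x : (rot T x \in black T) = (x \in black T).
Proof. by case: colored. Qed.

Lemma opp_colored x : x \notin dangling T -> (opp T x \in black T) = (x \notin black T).
Proof. by case: colored => _; apply. Qed.

Lemma opp_dangling x : (opp T x \in dangling T) = (x \in dangling T).
Proof. by rewrite !in_set oppK eq_sym. Qed.

Lemma bud_opp x : x \in dangling T -> opp T x = x.
Proof. by rewrite inE => /eqP. Qed.

Lemma white_opp x : x \notin black T -> opp T x \in opens T.
Proof.
move=> xW; have xD : x \notin dangling T by apply: contra xW; apply: (subsetP buds_black).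
by rewrite in_setD opp_dangling xD opp_colored.
Qed.

Lemma open_opp x : x \in opens T -> opp T x \notin black T.
Proof. by rewrite in_setD => /andP[xD xB]; rewrite opp_colored // negbK. Qed.

Lemma fnext_open_white x : x \in opens T -> s x \notin black T.
Proof. by move=> xP; rewrite -rot_colored rot_fnext open_opp. Qed.

Lemma black_open_or_bud x : x \in black T -> x \notin opens T -> x \in dangling T.
Proof. by move=> xB; rewrite in_setD xB andbT negbK. Qed.

Lemma climbs_ex z : exists2 x, x \in opens T & exists2 n, climbs x n & (s ^+ n) x = z.
Proof. exact: (rises_ex (disj_opens T) one_cycle more_opens). Qed.

Lemma half_black (x : T) : x \in black T -> exists b : BB, val b = x.
Proof. by move=> xB; exists (exist (fun x => x \in black T) x xB). Qed.

Lemma closure_opp_pair (b y : BB) : pairs (val b) (val y) ->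
  opp O (inl b) = inl y /\ opp O (inl y) = inl b.
Proof.
move=> h; rewrite !closure_oppE !(closure_opp_partner (b := b) (y := y)) //.
  by rewrite (closure_opp_partner (y := b)) // /partner h orbT.
by rewrite /partner h.
Qed.

Lemma closure_opp_root (b : BB) (u : UU) : val b = val u ->
  opp O (inl b) = inr u /\ opp O (inr u) = inl b.
Proof.
move=> e; rewrite !closure_oppE (closure_opp_free e) /=; split=> //.
by congr inl; apply: val_inj.
Qed.

Variant closure_edge_spec (b : BB) : Prop :=
  | PairedOpen (y : BB) of pairs (val b) (val y)
  | PairedBud (y : BB) of pairs (val y) (val b)
  | FreeOpen (u : UU) of val b = val u.

(** Every bud is matched because the excess is positive. *)
Lemma closure_edgeP b : closure_edge_spec b.
Proof.
have [bP|bN] := boolP (val b \in opens T); last first.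
  have bD := black_open_or_bud (valP b) bN.
  have [x xb] := matched_ex (disj_opens T) one_cycle more_opens bD.
  have [y ey] := half_black (opens_black (pairs_open xb)).
  by apply: (@PairedBud _ y); rewrite ey.
have [bU|bU] := boolP (val b \in free_opens).
  by apply: (@FreeOpen _ (exist (fun x => x \in free_opens) (val b) bU)).
move: bU; rewrite inE bP negb_forall => /existsP[y]; rewrite negbK => by_.
have [c ec] := half_black (subsetP buds_black _ (matched_end by_)).
by apply: (@PairedOpen _ c); rewrite ec.
Qed.

Lemma closure_orientation : orientation O.
Proof.
have pair (b y : BB) : pairs (val b) (val y) ->
    (val b \in opens T) /\ (val y \in opens T) = false.
  move=> h; rewrite (pairs_open h); split=> //; apply/negP => /open_notin_dangling.
  by rewrite (matched_end h).
case=> [b|u].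
  case: (closure_edgeP b) => [y h|y h|u e].
  - have [-> _] := closure_opp_pair h; have [h1 h2] := pair _ _ h.
    by rewrite !closure_outE h1 h2.
  - have [_ ->] := closure_opp_pair h; have [h1 h2] := pair _ _ h.
    by rewrite !closure_outE h1 h2.
  have [-> _] := closure_opp_root e.
  by rewrite !closure_outE e (free_opens_open (valP u)).
have [_ ->] := @closure_opp_root (free_black u) u (erefl _).
by rewrite !closure_outE /= (free_opens_open (valP u)).
Qed.

(** Otherwise the matching would map the openings injectively to the buds. *)
Lemma free_open_ex : exists x, x \in free_opens.
Proof.
case: (pickP (mem free_opens)) => [x xU|none]; first by exists x.
have [m mP] : exists m : T -> T, forall x, x \in opens T -> pairs x (m x).
  apply: (@fin_all_exists _ (fun _ => T : Type) (fun x y => x \in opens T -> pairs x y)).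
  move=> x; have [xP|] := boolP (x \in opens T); last by exists x.
  have := none x; rewrite /= inE xP => /negbT; rewrite negb_forall => /existsP[y].
  by rewrite negbK; exists y.
have : (#|opens T| <= #|dangling T|)%N.
  rewrite -(card_in_imset (f := m) (D := opens T)).
    by apply/subset_leq_card/subsetP => _ /imsetP[x xP ->]; apply: matched_end (mP x xP).
  move=> x y xP yP e; have := mP y yP; rewrite -e => h.
  exact: (matched_inj (disj_opens T) (mP x xP) h).
by rewrite leqNgt more_opens.
Qed.

Lemma closure_root_face : root_face O \in faces O.
Proof.
have [x xU] := free_open_ex; pose u : UU := exist (fun x => x \in free_opens) x xU; apply/imsetP; exists (inr u : O) => //.
have iter n (v : UU) :
    (fnext O ^+ n) (inr v) = inr ((induced_perm s free_opens ^+ n) v).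
  elim: n => [|n IH]; first by rewrite !perm_iter0.
  by rewrite !perm_iterS IH closure_fnextE.
apply/setP => h; rewrite closure_rootE; apply/idP/porbitP => [|[n ->]]; last by rewrite iter.
case: h => // v _; have : v \in porbit (induced_perm s free_opens) u.
  by rewrite porbit_induced one_cycle inE.
by case/porbitP=> n ->; exists n; rewrite iter.
Qed.

(** By induction on the length of the rise.  Removing its last excursion, from
    some [z] to the bud matched with [z], amounts to turning back by one step
    around the vertex, from the opposite of the half-edge of [b] to that of the
    half-edge of [z].  When only the opening and its neutral step are left, this
    leads to [q], the outgoing half-edge before that of [x]. *)
Lemma ingoing_corner x n (q b : BB) :
  climbs x n -> val b = (s ^+ n) x -> val q = opp T (s x) ->
  exists j, opp O (inl b) = (rot O ^+ j.+1) (inl q) /\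
    forall i, (0 < i <= j)%N -> (rot O ^+ i) (inl q) \notin out O.
Proof.
move=> + + eq; have dPN := disj_opens T.
elim/ltn_ind: n b => -[|[|n]] IH b r eb; first by case/risesP: r.
  have := valP b; rewrite eb perm_iter1 => zB.
  by have := fnext_open_white (rises_start dPN r); rewrite zB.
have [[yN [m [z [lt_mn rz ez zy]]]]|[yN yP ry]] := rises_back dPN one_cycle more_opens r.
  have [bz ebz] := half_black (opens_black (pairs_open zy)).
  have [by_ eby] := half_black (subsetP buds_black _ yN).
  have [|||j [ej no]] := IH m.+1 _ bz => //; first by rewrite ebz.
  have [e1 _] : opp O (inl bz) = inl by_ /\ opp O (inl by_) = inl bz.
    by apply: closure_opp_pair; rewrite ebz eby.
  exists j.+1; split.
    rewrite perm_iterS -ej e1; symmetry; apply: closure_rot.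
    by rewrite eby eb (perm_iterS s n.+1) rot_fnext bud_opp.
  move=> i /andP[i0]; rewrite leq_eqVlt => /orP[/eqP->|lt_ij].
    by rewrite -ej e1 closure_outE eby; apply/negP => /open_notin_dangling; rewrite yN.
  by apply: no; rewrite i0.
have yW : (s ^+ n.+1) x \notin black T.
  by apply: contra yN => yB; apply: black_open_or_bud.
case: n ry IH r eb yN yP yW => [|n] ry IH r eb yN yP yW.
  exists 0; split; last by move=> i; lia.
  rewrite perm_iter1; symmetry; apply: closure_rot.
  by rewrite eq eb perm_iterS perm_iter1 rot_fnext.
have [[wN _]|[wN wP _]] := rises_back dPN one_cycle more_opens ry.
  by case/negP: yW; rewrite perm_iterS -rot_colored rot_fnext bud_opp // (subsetP buds_black).
case/negP: wP; rewrite -[X in X \in _](@oppK T _); apply: white_opp.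
by rewrite -rot_fnext rot_colored -perm_iterS.
Qed.

(** If [x] is matched, its bud ends a rise from [x].  If it is not, the next
    unmatched opening does, and in the closure its half-edge in the root-face
    comes just before that of [x]. *)
Lemma next_outgoing x (q b : BB) : x \in opens T -> val b = x -> val q = opp T (s x) ->
  exists j, inl b = (rot O ^+ j.+1) (inl q) /\
    forall i, (0 < i < j.+1)%N -> (rot O ^+ i) (inl q) \notin out O.
Proof.
move=> xP eb eq; case: (closure_edgeP b) => [y|y|u eu].
- move=> /[dup] by_ /pairsP[n r [ey _]]; rewrite eb in r ey.
  have [j [ej no]] := ingoing_corner r (esym ey) eq.
  have [_ e2] := closure_opp_pair by_.
  by exists j; rewrite -e2 ej.
- by move/matched_end; rewrite eb => /(negP (open_notin_dangling xP)).
pose v := induced_perm s free_opens u.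
have [x' _ [n r ev]] := climbs_ex (val v).
have [x'U no'] : x' \in free_opens /\
    forall j, (0 < j < n)%N -> (s ^+ j) x' \notin free_opens.
  by apply: (rises_unmatched (disj_opens T) r); rewrite ev (valP v).
(* The next unmatched opening [v] ends a rise whose start is the unmatched
   opening before it, that is [x]. *)
have ex' : x' = x.
  pose u' : UU := exist (fun x => x \in free_opens) x' x'U.
  have : induced_perm s free_opens u' = v.
    have n0 : (0 < n)%N by case/risesP: r.
    by apply: (induced_perm_eq (k := n.-1)); rewrite prednK //= ?ev.
  by move/perm_inj => e; rewrite -eb eu -e.
rewrite ex' in r ev.
have [j [ej no]] := ingoing_corner (b := free_black v) r (esym ev) eq.
have [e1 e2] := @closure_opp_root (free_black v) v (erefl _).
have [_ e3] := closure_opp_root eu.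
exists j.+1; split.
  rewrite perm_iterS -ej e1 -e3; symmetry.
  by rewrite rotE; congr (opp O _); apply: (@perm_inj _ (fnext O)); rewrite permKV closure_fnextE.
move=> i /andP[i0]; rewrite ltnS leq_eqVlt => /orP[/eqP->|lt_ij].
  by rewrite -ej e1 closure_outE.
by apply: no; rewrite i0.
Qed.

Lemma closure_has_out : every_vertex_has_outgoing O.
Proof.
move=> _ /imsetP[h _ ->]; case e: (opp O h) => [b|u]; last first.
  exists h; first exact: porbit_id.
  by have := closure_orientation h; rewrite e closure_outE => /esym/negbFE.
have [x xP [n r eb]] := climbs_ex (val b).
have [q eq] := half_black (opens_black (white_opp (fnext_open_white xP))).
have [j [ej _]] := ingoing_corner r (esym eb) eq.
exists (inl q); last by rewrite closure_outE eq white_opp ?fnext_open_white.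
by rewrite porbit_sym -(oppK h) e ej mem_porbit.
Qed.

(** By [ingoing_corner] and [next_outgoing], the edge of [b] ends between two
    consecutive outgoing half-edges, the second of which is that of the parent
    [x]. *)
Lemma closure_step x n (b c : BB) e :
  climbs x n -> val b = (s ^+ n) x -> val b \in opens T -> val c = x ->
  rightmost_step (inl b : O) e -> e = inl c.
Proof.
move=> r eb bP ec; have xP := rises_start (disj_opens T) r.
have [q eq] := half_black (opens_black (white_opp (fnext_open_white xP))).
have [j [ej no]] := ingoing_corner r eb eq.
have [k [ek nok]] := next_outgoing xP ec eq.
move=> st; apply: rightmost_step_fun st _.
have bO : opp O (inl b) \notin out O by rewrite closure_orientation closure_outE bP.
have cO : (inl c : O) \in out O by rewrite closure_outE ec.
have lt_jk : (j < k)%N.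
  rewrite ltnNge leq_eqVlt; apply/negP => /orP[/eqP ekj|lt_kj].
    by move: bO; rewrite ej -ekj -ek cO.
  by have := no k.+1; rewrite -ek cO lt_kj => /(_ isT).
exists (k - j.+1)%N; split=> //; rewrite ej.
  by rewrite -perm_iterD ek; congr ((rot O ^+ _) _); lia.
by move=> i hi; rewrite -perm_iterD; apply: nok; lia.
Qed.

(** Along a rightmost walk the excursions get longer, by [match_longer], so that an
    unmatched opening is reached. *)
Lemma closure_right : right_orientation O.
Proof.
split; [exact: closure_orientation|exact: closure_has_out|move=> e eO w [w0 walk]].
have w_out n : w n \in out O.
  by case: n => [|n]; [rewrite w0|case: (walk n) => j []].
have [N NR] : exists N, opp O (w N) \in root_face O.
  have w_open n : exists2 b : BB, w n = inl b & val b \in opens T.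
    by have := w_out n; rewrite closure_outE; case: (w n) => // b bP; exists b.
  (* [m] bounds the number of steps left before the length of the excursions
     reaches the order of [s]. *)
  have climb m n b l : w n = inl b -> climbs (val b) l ->
      (s ^+ l) (val b) \in dangling T -> (#[s] <= l + m)%N ->
      exists N, opp O (w N) \in root_face O.
    elim: m n b l => [|m IH] n b l eb r lN le_l.
      by have := excursion_bound (disj_opens T) r lN; lia.
    have [x xP [k rx ex]] := climbs_ex (val b).
    have [c ec] := half_black (opens_black xP).
    have bP := rises_start (disj_opens T) r.
    have ew : w n.+1 = inl c.
      by apply: closure_step rx (esym ex) bP ec _; rewrite -eb.
    case: (closure_edgeP c) => [y|y|u eu].
    - move=> /pairsP[l' r' [el' yN]].
      apply: (IH n.+1 c l') => //; first by rewrite el'.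
      have : (l < l')%N.
        rewrite ec in r' el'; rewrite -ex in r lN.
        by apply: (match_longer (disj_opens T) rx r) r' _; rewrite ?perm_iterD ?el'.
      by lia.
    - by move/matched_end; rewrite ec => /(negP (open_notin_dangling xP)).
    by exists n.+1; rewrite ew; have [-> _] := closure_opp_root eu; rewrite closure_rootE.
  have [b eb bP] := w_open 0.
  case: (closure_edgeP b) => [y|y|u eu].
  - move=> /pairsP[l r [el yN]]; apply: (climb #[s] 0 b l) => //; first by rewrite el.
    exact: leq_addl.
  - by move/matched_end => /(negP (open_notin_dangling bP)).
  by exists 0; rewrite eb; have [-> _] := closure_opp_root eu; rewrite closure_rootE.
exists N => // k.
suff [] : w (N + k)%N = ((opp O * rot O) ^+ k) (w N) /\ opp O (w (N + k)%N) \in root_face O.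
  by [].
elim: k => [|k [IH kR]]; first by rewrite addn0 perm_iter0.
have [st R'] :=
  root_step closure_orientation closure_root_face closure_root_not_out kR.
have ew := rightmost_step_fun (walk (N + k)%N) st.
by rewrite addnS perm_iterS permM -IH ew.
Qed.

(** The contour of the mobile visits all its half-edges, and each of its steps
    joins half-edges of the same component of the closure. *)
Lemma closure_connected : connected O.
Proof.
have [x xU] := free_open_ex.
pose u : UU := exist (fun x => x \in free_opens) x xU.
apply: (@connected_orbit O (inl (free_black u))) => h.
set orb := orbit _ _ _.
have rot_iter n y : ((rot O ^+ n) y \in orb) = (y \in orb).
  by elim: n => [|n IH]; rewrite ?perm_iter0 // perm_iterS orbit_rot.
have prev (b y : BB) : val y = rot T (val b) -> (inl y : O) \in orb -> (inl b : O) \in orb.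
  by move=> /closure_rot e; rewrite -orbit_rot -orbit_opp e oppK.
have all_iter n : forall b : BB,
    (val b = (s ^+ n) (val u) -> (inl b : O) \in orb) /\
    ((s ^+ n) (val u) \notin black T -> val b = opp T ((s ^+ n) (val u)) ->
     (inl b : O) \in orb).
  elim: n => [|n IH] b.
    rewrite perm_iter0; split=> [e|]; last by rewrite (valP (free_black u)).
    by rewrite (_ : b = free_black u) ?orbit_refl //; apply: val_inj.
  move: IH; rewrite !perm_iterS; set t := (s ^+ n) (val u) => IH.
  have [tB|tW] := boolP (t \in black T); last first.
    have [c ec] := half_black (opens_black (white_opp tW)).
    have cO : (inl c : O) \in orb by case: (IH c) => _; apply.
    split=> [e|]; first by apply: prev cO; rewrite e rot_fnext.
    by rewrite -rot_colored rot_fnext (opens_black (white_opp tW)).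
  have [c ec] := half_black tB; have cO : (inl c : O) \in orb by case: (IH c) => + _; apply.
  have [tP|tN] := boolP (t \in opens T).
    split=> [e|_ e]; first by have := fnext_open_white tP; rewrite -e (valP b).
    have [j [ej _]] := next_outgoing tP ec e.
    by rewrite -(rot_iter j.+1) -ej.
  have tD := black_open_or_bud tB tN.
  split=> [e|]; first by apply: prev cO; rewrite e rot_fnext bud_opp.
  by rewrite -rot_colored rot_fnext bud_opp // tB.
have all_black (b : BB) : (inl b : O) \in orb.
  have : val b \in porbit s (val u) by rewrite one_cycle inE.
  by case/porbitP=> n e; case: (all_iter n b) => + _; apply.
case: h => [b|v]; first exact: all_black.
have [_ e] := @closure_opp_root (free_black v) v (erefl _).
by rewrite -orbit_opp e all_black.
Qed.

(** The values on half-edges of the root-face, which give no half-edge of the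
    mobile, are arbitrary. *)
Definition closure_unslot (x : Phi_plus O) : T :=
  match val x with
  | inl (inl b) => opp T (val b)
  | inr (inl b) => val b
  | inl (inr u) | inr (inr u) => val u
  end.

(** At the white vertices, [next_outgoing] says that the rotation of the mobile is
    the one induced by the closure on outgoing half-edges. *)
Lemma closure_phi_iso : mobile_iso (Phi_plus O) T.
Proof.
have rf := closure_root_face; have rno := closure_root_not_out.
have whiteE x (h : O) : val x = inl h ->
    exists2 b : BB, h = inl b /\ val b \in opens T & closure_unslot x = opp T (val b).
  move=> ex; have := slot_white ex; rewrite closure_outE /closure_unslot ex.
  by case: h {ex} => // b bP; exists b.
have blackE x (h : O) : val x = inr h ->
    exists2 b : BB, h = inl b & closure_unslot x = val b.
  move=> ex; have := slot_black ex; rewrite closure_rootE /closure_unslot ex.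
  by case: h {ex} => // b _; exists b.
have F_black x : (closure_unslot x \in black T) = (x \in black (Phi_plus O)).
  rewrite mem_black; case ex: (val x) => [h|h].
    by have [b [_ bP] ->] := whiteE _ _ ex; rewrite (negPf (open_opp bP)).
  by have [b _ ->] := blackE _ _ ex; rewrite (valP b).
have F_inj : injective closure_unslot.
  move=> x y e; have := F_black x; rewrite e F_black !mem_black.
  case ex: (val x) => [h|h]; case ey: (val y) => [k|k] // _; apply: val_inj.
    have [b [eh _] eb] := whiteE _ _ ex; have [c [ek _] ec] := whiteE _ _ ey.
    rewrite ex ey eh ek; congr (inl (inl _)); apply: val_inj.
    by apply: (@oppr_inj T); rewrite -eb -ec.
  have [b eh eb] := blackE _ _ ex; have [c ek ec] := blackE _ _ ey.
  by rewrite ex ey eh ek; congr (inr (inl _)); apply: val_inj; rewrite -eb -ec.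
have F_surj t : exists x, closure_unslot x = t.
  have [tB|tW] := boolP (t \in black T).
    have [b eb] := half_black tB.
    have [|x ex] := @black_slot O (inl b); first by rewrite closure_rootE.
    by exists x; rewrite /closure_unslot ex.
  have [b eb] := half_black (opens_black (white_opp tW)).
  have [|x ex] := @white_slot O rno (inl b); first by rewrite closure_outE eb white_opp.
  by exists x; rewrite /closure_unslot ex eb oppK.
exists closure_unslot; split=> //.
- have [G GP] := fin_all_exists F_surj.
  by exists G => // x; apply: F_inj; rewrite GP.
- move=> x; case ex: (val x) => [h|h].
    have [b [eh bP] ->] := whiteE _ _ ex; rewrite eh in ex.
    have [k [ek no]] := rot_white rno ex.
    have [c [ec cP] ->] := whiteE _ _ ek.
    pose y := opp T (rot T (opp T (val b))).
    have yP : y \in opens T by rewrite white_opp // rot_colored open_opp.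
    have [z ez] := half_black (opens_black yP).
    have [|j [ej no']] := next_outgoing (q := b) yP ez.
      by rewrite (fnext_eq (k := opp T (val b))) ?oppK // /y oppK.
    have kj : k = j.
      apply: (first_visit_uniq _ no _ no').
        by rewrite ec closure_outE.
      by rewrite -ej closure_outE ez.
    move: ec; rewrite kj -ej => -[<-].
    by rewrite ez /y oppK.
  have [b eh ->] := blackE _ _ ex; rewrite eh in ex.
  have := rot_black rf ex; rewrite /closure_unslot closure_fnextE => -> /=.
  have [y ey] : exists y : BB, val y = rot T (val b).
    by apply: half_black; rewrite rot_colored (valP b).
  rewrite -ey; congr val; apply: (@induced_perm_eq _ _ _ b y 0).
    by case=> [|j] /andP[].
  by rewrite perm_iter1.
move=> x; case ex: (val x) => [h|h].
  have [b [eh _] ->] := whiteE _ _ ex; rewrite eh in ex.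
  by rewrite /closure_unslot (opp_white ex) oppK.
have [b eh ->] := blackE _ _ ex; rewrite eh in ex.
have [bP|bN] := boolP (val b \in opens T).
  by rewrite /closure_unslot (opp_black ex) // closure_outE.
rewrite (opp_bud ex) ?closure_outE // /closure_unslot ex bud_opp //.
exact: black_open_or_bud (valP b) bN.
Qed.

End Closure.

Lemma mobile_closure d g (T : mobile_data) : (0 < d)%N -> mobiles d g T ->
  exists2 O, right_orientations d g O & mobile_iso (Phi_plus O) T.
Proof.
move=> d0 [[[conn gen] f1 col bb] exc].
have one x : porbit (fnext T) x = [set: T].
  have /eqP/cards1P[X eX] := f1.
  have eq y : porbit (fnext T) y = X.
    by apply/set1P; rewrite -eX imset_f.
  by apply/setP => y; rewrite inE eq -(eq y) porbit_id.
have more : (#|dangling T| < #|opens T|)%N.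
  move: exc; rewrite /excess (card_edges (disj_opens T)); first by lia.
  move=> h hd; rewrite !in_setD hd (opp_dangling h) hd /=.
  by case: col => _ ->.
have iso := closure_phi_iso col bb one more.
exists (closure_omap T) => //.
have or := closure_orientation bb one more.
have rf := closure_root_face one more.
have rno := @closure_root_not_out T.
have ho := closure_has_out col bb one more.
have [F [bF Fr Fo _]] := iso; have [_ cV cF cE cD] := iso_card bF Fr Fo.
split; last exact: closure_right.
  split=> //.
  - split; first exact: closure_connected.
    apply/(genus_phi or ho rf rno g); first by rewrite cF.
    by rewrite /has_genus cV cE cF.
  apply/setP => h; rewrite in_set0 in_set; apply/negP => /eqP e.
  by have := or h; rewrite e; case: (h \in out _).
by have := excess_phi or rf rno; move: exc; rewrite /excess cE cD => -> [].
Qed.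

Theorem theorem14 (d g : nat) (hd : (1 <= d)%N) :
  bijection_on_classes (right_orientations d g) omap_iso
                       (mobiles d g) mobile_iso Phi_plus.
Proof.
split.
- by move=> O; apply: right_orientation_mobile.
- by move=> O O' _ _; apply: omap_iso_phi.
- exact: phi_iso_omap.
by move=> T /(mobile_closure hd)[O]; exists O.
Qed.
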